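(* Let $p \in [1, \infty)$, let $G$ be a second countable locally compact abelian group, and let $(G, A, \alpha)$ be an isometric $G$-$L^p$ operator algebra such that $A$ is separable and nondegenerately representable. Then there exists a unique continuous isometric action $\tau \mapsto \widehat{\alpha}_\tau$ of the Pontryagin dual $\widehat{G}$ on $F^p_{\mathrm r}(G, A, \alpha)$ such that the canonical map $\iota_{\mathrm r} \colon C_{\mathrm c}(G, A, \alpha) \to F^p_{\mathrm r}(G, A, \alpha)$ is equivariant, where $\widehat G$ acts on $C_{\mathrm c}(G, A, \alpha)$ by $\widehat{\alpha}_\tau(a)(g) = \overline{\tau(g)}\, a(g)$ for $\tau\in\widehat G$, $a\in C_{\mathrm c}(G,A,\alpha)$, and $g\in G$.
   Context: $L(E)$ is the algebra of bounded operators on a Banach space $E$. An $L^p$ operator algebra is a Banach algebra (not necessarily unital) isometrically isomorphic to a norm closed subalgebra of $L(L^p(X,\mu))$ for some measure space $(X,\mathcal B,\mu)$. A representation of $A$ on $L^p(X,\mu)$ is a continuous homomorphism $\pi\colon A\to L(L^p(X,\mu))$; it is contractive if $\|\pi(a)\|\le\|a\|$ for all $a$, isometric if $\|\pi(a)\|=\|a\|$ for all $a$, $\sigma$-finite if $\mu$ is $\sigma$-finite, and nondegenerate if the span of $\{\pi(a)\xi\}$ is dense. $A$ is nondegenerately representable if it has a nondegenerate isometric representation. (A separable nondegenerately representable $L^p$ operator algebra automatically has a nondegenerate $\sigma$-finite isometric representation.) An action of a topological group $H$ on a Banach algebra $B$ is a homomorphism $h\mapsto\beta_h$ from $H$ to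 the continuous algebra automorphisms of $B$ such that $h\mapsto\beta_h(b)$ is continuous for every $b\in B$ (this is what ''continuous'' refers to); it is isometric if every $\beta_h$ is isometric. An isometric $G$-$L^p$ operator algebra $(G,A,\alpha)$ is an $L^p$ operator algebra $A$ with an isometric action $\alpha$ of $G$. $\nu$ is a Haar measure on $G$. Given a contractive representation $\pi_0\colon A\to L(L^p(X,\mu))$, the associated regular covariant representation $(v,\pi)$ acts on $L^p(G\times X,\nu\times\mu)$ by $(v_g\xi)(h,x)=\xi(g^{-1}h,x)$ and, for $\xi\in C_{\mathrm c}(G,L^p(X,\mu))$ (a dense subspace), $(\pi(a)\xi)(h)=\pi_0(\alpha_h^{-1}(a))(\xi(h))$. $C_{\mathrm c}(G,A,\alpha)$ is the space of compactly supported continuous functions $G\to A$ with product $(ab)(g)=\int_G a(h)\alpha_h(b(h^{-1}g))\,d\nu(h)$, and $(v\ltimes\pi)(a)\xi=\int_G\pi(a(g))v_g\xi\,d\nu(g)$. The reduced $L^p$ operator crossed product $F^p_{\mathrm r}(G,A,\alpha)$ is the Hausdorff completion of $C_{\mathrm c}(G,A,\alpha)$ in the seminorm $a\mapsto\sup\|(v\ltimes\pi)(a)\|$, over all regular covariant representations $(v,\pi)$ coming from nondegenerate $\sigma$-finite contractive representations $\pi_0$ of $A$ on $L^p$ spaces; $\iota_{\mathrm r}$ is the canonical map to the completion. *)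

(* Defs.v *)
(* Everything is done over the complex numbers R[i], for R : realType. *)
From HB Require Import structures.
From mathcomp Require Import all_boot all_order all_algebra.
From mathcomp Require Import all_classical all_reals all_analysis.
From mathcomp Require Import measurable_realfun complex.

Set Implicit Arguments.
Unset Strict Implicit.
Unset Printing Implicit Defensive.

Import Order.TTheory GRing.Theory Num.Theory.
Import numFieldNormedType.Exports.

Local Open Scope classical_set_scope.
Local Open Scope complex_scope.
Local Open Scope ring_scope.

(* Over the field R[i] the norms of the library take values in R[i]; [nrm] is
   the corresponding real number. *)
Definition nrm (R : realType) (V : normedZmodType R[i]) (v : V) : R :=
  complex.Re `|v|.

Section nrm.
Context (R : realType).

Lemma nrmC (V : normedZmodType R[i]) (v : V) : (nrm v)%:C = `|v|.
Proof.
have /ger0_real := normr_ge0 v; rewrite /nrm.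
have : 0 <= `|v| := normr_ge0 v.
by case: `|v| => a b; rewrite lecE /= => /andP[/eqP -> _].
Qed.

Lemma nrm_ge0 (V : normedZmodType R[i]) (v : V) : 0 <= nrm v.
Proof. by rewrite -ler0c nrmC. Qed.

Lemma nrm0 (V : normedZmodType R[i]) : nrm (0 : V) = 0.
Proof. by rewrite /nrm normr0. Qed.

Lemma nrm_eq0 (V : normedZmodType R[i]) (v : V) : nrm v = 0 -> v = 0.
Proof. by move=> v0; apply/normr0_eq0; rewrite -nrmC v0. Qed.

Lemma ler_nrmD (V : normedZmodType R[i]) (u v : V) : nrm (u + v) <= nrm u + nrm v.
Proof. by rewrite -lecR rmorphD /= !nrmC ler_normD. Qed.

Lemma nrmZ (V : normedModType R[i]) (a : R[i]) (v : V) :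
  nrm (a *: v) = nrm a * nrm v.
Proof. by apply: complexI; rewrite rmorphM /= !nrmC normrZ. Qed.

Lemma nrmM (a b : R[i]) : nrm (a * b) = nrm a * nrm b.
Proof. by apply: complexI; rewrite rmorphM /= !nrmC normrM. Qed.

Lemma nrmE (z : R[i]) : nrm z = Num.sqrt (complex.Re z ^+ 2 + complex.Im z ^+ 2).
Proof. by case: z. Qed.

End nrm.

Section Lp.
Context d (X : measurableType d) (R : realType).
Context (mu : {measure set X -> \bar R}) (p : R).

(* [R[i]] carries no sigma-algebra in the library; this is Borel measurability
   for R[i] = R^2. *)
Definition cmeasurable (f : X -> R[i]) : Prop :=
  measurable_fun setT (fun x => complex.Re (f x)) /\
  measurable_fun setT (fun x => complex.Im (f x)).


Lemma cmeasurable_nrm f : cmeasurable f -> measurable_fun setT (fun x => nrm (f x)).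
Proof.
move=> [mr mi].
under eq_fun do rewrite nrmE.
apply: measurableT_comp => //; first by apply: continuous_measurable_fun; exact: sqrt_continuous.
by apply: measurable_funD; exact: measurable_funX.
Qed.

Hypothesis p1 : 1 <= p.

Let p1E : (1 <= p%:E)%E. Proof. by rewrite lee_fin. Qed.
Let p0 : p != 0. Proof. by rewrite gt_eqF// (lt_le_trans ltr01). Qed.

Lemma cmeasurableZ (a : R[i]) f : cmeasurable f -> cmeasurable (a *: f).
Proof.
move=> [mr mi]; case: a => a b; split.
  rewrite (_ : (fun _ => _) =
    (fun x => a * complex.Re (f x) - b * complex.Im (f x))); last first.
    by apply/funext => x; rewrite fctE; case: (f x).
  by apply: measurable_funB; exact: measurable_funM.
rewrite (_ : (fun _ => _) =
  (fun x => a * complex.Im (f x) + b * complex.Re (f x))); last first.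
  by apply/funext => x; rewrite fctE; case: (f x).
by apply: measurable_funD; exact: measurable_funM.
Qed.

Lemma cmeasurableD f g : cmeasurable f -> cmeasurable g -> cmeasurable (f + g).
Proof.
move=> [fr fi] [gr gi]; split.
  rewrite (_ : (fun _ => _) = (fun x => complex.Re (f x) + complex.Re (g x))).
    exact: measurable_funD.
  by apply/funext => x; rewrite fctE; case: (f x); case: (g x).
rewrite (_ : (fun _ => _) = (fun x => complex.Im (f x) + complex.Im (g x))).
  exact: measurable_funD.
by apply/funext => x; rewrite fctE; case: (f x); case: (g x).
Qed.

Lemma Lnorm_mono (f g : X -> R) : measurable_fun setT f -> measurable_fun setT g ->
  (forall x, 0 <= f x <= g x) ->
  ('N[mu]_p%:E[EFin \o f] <= 'N[mu]_p%:E[EFin \o g])%E.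
Proof.
move=> mf mg fg; rewrite unlock /Lnorm.
have m (h : X -> R) : measurable_fun setT h ->
    measurable_fun setT (fun x => `|(EFin \o h) x| `^ p)%E.
  move=> mh; apply: (@measurableT_comp _ _ _ _ _ _ (fun x => x `^ p)%E) => //=.
    exact: measurable_poweR.
  by apply/measurable_EFinP; exact: measurableT_comp.
have i0 (h : X -> R) : (\int[mu]_x `|(EFin \o h) x| `^ p \in `[0, +oo])%E.
  by rewrite in_itv /= leey andbT; apply: integral_ge0 => x _.
apply: gt0_ler_poweR; [by rewrite invr_ge0 (le_trans ler01)|exact: i0|exact: i0|].
apply: ge0_le_integral => //.
- by move=> x _; exact: poweR_ge0.
- exact: m.
- exact: m.
move=> x _; have /andP[f0 fgx] := fg x.
apply: gt0_ler_poweR; rewrite ?in_itv/= ?leey ?andbT ?abse_ge0//.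
  by rewrite (le_trans ler01).
by rewrite lee_fin !ger0_norm// (le_trans f0).
Qed.

Lemma Lnorm_scale (k : R) (f : X -> R) : 0 <= k -> measurable_fun setT f ->
  ('N[mu]_p%:E[EFin \o (fun x => (k * f x)%R)] = k%:E * 'N[mu]_p%:E[EFin \o f])%E.
Proof.
move=> k0 mf; rewrite unlock /Lnorm.
have m : measurable_fun setT (fun x => `|(EFin \o f) x| `^ p)%E.
  apply: (@measurableT_comp _ _ _ _ _ _ (fun x => x `^ p)%E) => //=.
    exact: measurable_poweR.
  by apply/measurable_EFinP; exact: measurableT_comp.
under eq_integral do rewrite /= normrM powRM ?normr_ge0// EFinM.
rewrite ge0_integralZl//.
rewrite poweRM ?integral_ge0//.
by rewrite poweR_EFin -powRrM mulfV// powRr1// ger0_norm.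
Qed.

Definition is_Lp_fun (_ : 1 <= p) : {pred X -> R[i]} :=
  mem [set f | cmeasurable f /\ finite_norm mu p%:E (fun x => nrm (f x))].

Lemma Lp_submod_closed : submod_closed (is_Lp_fun p1).
Proof.
split.
  rewrite inE; split.
    by split; apply: measurable_cst.
  rewrite /finite_norm (_ : _ \o _ = cst 0%E); last first.
    by apply/funext => x /=; rewrite nrm0.
  by rewrite Lnorm0 ?ltry// eqe.
move=> a f g; rewrite !inE /= => -[mf nf] [mg ng]; split.
  by apply: cmeasurableD => //; exact: cmeasurableZ.
have mf' := cmeasurable_nrm mf; have mg' := cmeasurable_nrm mg.
have maf : measurable_fun setT (fun x => nrm a * nrm (f x)) by exact: measurable_funM.
rewrite /finite_norm.
apply: (@le_lt_trans _ _ ('N[mu]_p%:E[EFin \o ((fun x => nrm a * nrm (f x)) \+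
    (fun x => nrm (g x)))%R]%E)).
  apply: Lnorm_mono => //.
  - by apply: cmeasurable_nrm; apply: cmeasurableD => //; exact: cmeasurableZ.
  - exact: measurable_funD.
  - by move=> x; rewrite nrm_ge0 /= (le_trans (ler_nrmD _ _))// lerD2r nrmM.
apply: (le_lt_trans (eminkowski _ _ _ _)) => //.
rewrite lte_add_pinfty// Lnorm_scale ?nrm_ge0//.
by rewrite lte_mul_pinfty// lee_fin nrm_ge0.
Qed.

HB.instance Definition _ := GRing.isSubmodClosed.Build R[i] (X -> R[i]) (is_Lp_fun p1)
  Lp_submod_closed.

End Lp.

Section LpSpace.
Context d (X : measurableType d) (R : realType).
Context (mu : {measure set X -> \bar R}) (p : R) (p1 : 1 <= p).

(* L^p(X, mu) is the quotient of the space LpFun of p-integrable functions by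
   the subspace of the functions vanishing almost everywhere, with the norm
   'N[mu]_p of the modulus. *)
Record LpFun := MkLpFun {
  LpFun_val :> X -> R[i] ;
  LpFunP : LpFun_val \in is_Lp_fun mu p1 }.

HB.instance Definition _ := [isSub for LpFun_val].
HB.instance Definition _ := [Choice of LpFun by <:].
HB.instance Definition _ := [SubChoice_isSubLmodule of LpFun by <:].

Definition ae_null : {pred LpFun} := mem [set f : LpFun | {ae mu, forall x, f x = 0}].

Lemma ae_null_submod_closed : submod_closed ae_null.
Proof.
split; first by rewrite inE /=; apply/nearW.
move=> a f g; rewrite !inE /= => f0 g0.
by apply: filterS2 f0 g0 => x fx gx; rewrite /= !fctE fx gx scaler0 addr0.
Qed.

HB.instance Definition _ := GRing.isSubmodClosed.Build R[i] LpFun ae_null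
  ae_null_submod_closed.

Definition Lp : Type := Quotient.quot ae_null.

HB.instance Definition _ := GRing.Zmodule.on Lp.
HB.instance Definition _ := EqQuotient.on Lp.

Local Open Scope quotient_scope.

Definition Lp_pi (f : LpFun) : Lp := \pi_Lp f.

(* an arbitrary representative of the class *)
Definition Lp_fun (x : Lp) : X -> R[i] := LpFun_val (repr x).

Lemma Lp_piK (x : Lp) : Lp_pi (repr x) = x. Proof. exact: reprK. Qed.

Lemma Lp_piP (f g : LpFun) :
  Lp_pi f = Lp_pi g <-> {ae mu, forall x, f x = g x}.
Proof.
have -> : (Lp_pi f = Lp_pi g) <-> (f - g \in ae_null).
  by rewrite Quotient.idealrBE; split=> /eqP.
rewrite inE /=; split; apply: filterS => x /=.
  by move=> /eqP; rewrite !fctE subr_eq0 => /eqP.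
by rewrite !fctE => ->; rewrite subrr.
Qed.

Lemma Lp_repr (f : LpFun) : {ae mu, forall x, repr (Lp_pi f) x = f x}.
Proof. by apply/Lp_piP; rewrite Lp_piK. Qed.

Lemma Lp_piD (f g : LpFun) : Lp_pi (f + g) = Lp_pi f + Lp_pi g.
Proof. by rewrite /Lp_pi !piE. Qed.

Definition Lp_scale (a : R[i]) (x : Lp) : Lp := Lp_pi (a *: repr x).

Lemma Lp_piZ (a : R[i]) (f : LpFun) : Lp_scale a (Lp_pi f) = Lp_pi (a *: f).
Proof.
by apply/Lp_piP; apply: filterS (Lp_repr f) => x /= fx; rewrite !fctE fx.
Qed.

Lemma Lp_scaleA a b x : Lp_scale a (Lp_scale b x) = Lp_scale (a * b) x.
Proof. by rewrite -(Lp_piK x) !Lp_piZ scalerA. Qed.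

Lemma Lp_scale1 : left_id 1 Lp_scale.
Proof. by move=> x; rewrite -(Lp_piK x) !Lp_piZ scale1r. Qed.

Lemma Lp_scaleDr : right_distributive Lp_scale +%R.
Proof.
by move=> a x y; rewrite -(Lp_piK x) -(Lp_piK y) -Lp_piD !Lp_piZ scalerDr Lp_piD.
Qed.

Lemma Lp_scaleDl x : {morph Lp_scale^~ x : a b / a + b}.
Proof. by move=> a b; rewrite -(Lp_piK x) !Lp_piZ scalerDl Lp_piD. Qed.

HB.instance Definition _ := GRing.Zmodule_isLmodule.Build R[i] Lp
  Lp_scaleA Lp_scale1 Lp_scaleDr Lp_scaleDl.

Definition Lp_enorm (f : X -> R[i]) : \bar R :=
  ('N[mu]_p%:E[EFin \o (fun x => nrm (f x))])%E.

Definition Lp_norm (x : Lp) : R := fine (Lp_enorm (repr x)).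

Let p0 : p != 0. Proof. by rewrite gt_eqF// (lt_le_trans ltr01). Qed.

Lemma LpFun_measurable (f : LpFun) : cmeasurable f.
Proof. by have := LpFunP f; rewrite inE => -[]. Qed.

Lemma LpFun_fin (f : LpFun) : Lp_enorm f \is a fin_num.
Proof.
have := LpFunP f; rewrite inE => -[_ h].
by rewrite ge0_fin_numE// Lnorm_ge0.
Qed.

Lemma Lp_enorm_ae (f g : LpFun) : {ae mu, forall x, f x = g x} ->
  Lp_enorm f = Lp_enorm g.
Proof.
move=> fg; rewrite /Lp_enorm unlock /Lnorm; congr (_ `^ _)%E.
have m (h : LpFun) : measurable_fun setT (fun x => `|(EFin \o (fun y => nrm (h y))) x| `^ p)%E.
  apply: (@measurableT_comp _ _ _ _ _ _ (fun x => x `^ p)%E) => //=.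
    exact: measurable_poweR.
  apply/measurable_EFinP; apply: measurableT_comp => //.
  exact/cmeasurable_nrm/LpFun_measurable.
apply: ae_eq_integral => //.
by apply: filterS fg => x /= -> _.
Qed.

Lemma Lp_norm_pi (f : LpFun) : Lp_norm (Lp_pi f) = fine (Lp_enorm f).
Proof. by congr fine; apply: Lp_enorm_ae; exact: Lp_repr. Qed.

Lemma Lp_enormD (f g : LpFun) : (Lp_enorm (f + g)%R <= Lp_enorm f + Lp_enorm g)%E.
Proof.
have mf := cmeasurable_nrm (LpFun_measurable f).
have mg := cmeasurable_nrm (LpFun_measurable g).
apply: (le_trans _ (eminkowski mu mf mg _)); last by rewrite lee_fin.
apply: Lnorm_mono => //.
- exact/cmeasurable_nrm/LpFun_measurable.
- exact: measurable_funD.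
- by move=> x; rewrite nrm_ge0 /= ler_nrmD.
Qed.

Lemma Lp_enormZ (a : R[i]) (f : LpFun) :
  (Lp_enorm (a *: f)%R = (nrm a)%:E * Lp_enorm f)%E.
Proof.
have mf := cmeasurable_nrm (LpFun_measurable f).
rewrite /Lp_enorm -Lnorm_scale ?nrm_ge0//; congr (Lnorm _ _ (_ \o _)).
by apply/funext => x; rewrite -nrmM.
Qed.

Definition Lp_cnorm (x : Lp) : R[i] := (Lp_norm x)%:C.

Lemma Lp_cnormD x y : Lp_cnorm (x + y) <= Lp_cnorm x + Lp_cnorm y.
Proof.
rewrite /Lp_cnorm -rmorphD lecR -(Lp_piK x) -(Lp_piK y) -Lp_piD !Lp_norm_pi.
rewrite -lee_fin EFinD !fineK ?LpFun_fin//; exact: Lp_enormD.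
Qed.

Lemma Lp_cnormZ (a : R[i]) x : Lp_cnorm (a *: x) = `|a| * Lp_cnorm x.
Proof.
rewrite /Lp_cnorm -nrmC -rmorphM -(Lp_piK x); congr (_%:C).
rewrite -[a *: _]/(Lp_scale a _) Lp_piZ !Lp_norm_pi Lp_enormZ fineM//.
exact: LpFun_fin.
Qed.

Lemma Lp_cnorm_eq0 x : Lp_cnorm x = 0 -> x = 0.
Proof.
move=> /complexI; rewrite -(Lp_piK x) Lp_norm_pi => x0.
have m := cmeasurable_nrm (LpFun_measurable (repr x)).
have {}x0 : Lp_enorm (repr x) = 0%E by rewrite -(fineK (LpFun_fin _)) x0.
have p_gt0 : (0 < p%:E)%E by rewrite lte_fin (lt_le_trans ltr01).
have /measurable_EFinP m' := m.
have := Lnorm_eq0_eq0 m' p_gt0 x0.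
rewrite -[RHS](_ : Lp_pi 0 = 0); last by rewrite /Lp_pi !piE.
move=> h; apply/Lp_piP; apply: filterS h => y /= /(_ I) [].
exact: nrm_eq0.
Qed.

HB.instance Definition _ := Lmodule_isNormed.Build R[i] Lp
  Lp_cnormD Lp_cnormZ Lp_cnorm_eq0.

End LpSpace.

Section dual.
Context (R : realType) (G : topologicalZmodType).

(* The Pontryagin dual of G, written additively like every abelian group here:
   (s + t) g = s g * t g. *)
Record dual := MkDual {
  dual_fun :> G -> R[i] ;
  dual_continuous : continuous (dual_fun : G -> R[i]^o) ;
  dualD : forall g h, dual_fun (g + h) = dual_fun g * dual_fun h ;
  dual_norm1 : forall g, `|dual_fun g| = 1 }.

Lemma dual_eq (s t : dual) : s =1 t -> s = t.
Proof.
case: s t => [s sc sD s1] [t tc tD t1] /= /funext st; subst t.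
by congr MkDual; exact: Prop_irrelevance.
Qed.

HB.instance Definition _ := gen_eqMixin dual.
HB.instance Definition _ := gen_choiceMixin dual.

Lemma continuous_mulC (f g : G -> R[i]) :
  continuous (f : G -> R[i]^o) -> continuous (g : G -> R[i]^o) ->
  continuous ((fun x => f x * g x) : G -> R[i]^o).
Proof. by move=> cf cg x; apply: cvgM; [exact: cf|exact: cg]. Qed.

Lemma conjc_sub_norm (z w : R[i]) : `|z^* - w^*| = `|z - w|.
Proof. by rewrite -rmorphB -!nrmC !nrmE; case: (z - w) => a b /=; rewrite sqrrN. Qed.

Lemma conjc_norm (z : R[i]) : `|z^*| = `|z|.
Proof. by have := conjc_sub_norm z 0; rewrite rmorph0 !subr0. Qed.

Lemma continuous_conjc (f : G -> R[i]) :
  continuous (f : G -> R[i]^o) -> continuous ((fun x => (f x)^*) : G -> R[i]^o).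
Proof.
move=> cf x; apply/cvgrPdist_lt => e e0.
have /cvgrPdist_lt /(_ e e0) := cf x.
by apply: filterS => y; rewrite conjc_sub_norm.
Qed.

Lemma dual_addD (s t : dual) g h :
  s (g + h) * t (g + h) = s g * t g * (s h * t h).
Proof. by rewrite !dualD mulrACA. Qed.

Lemma dual_add1 (s t : dual) g : `|s g * t g| = 1.
Proof. by rewrite normrM !dual_norm1 mulr1. Qed.

Definition dual_add (s t : dual) : dual :=
  MkDual (continuous_mulC (@dual_continuous s) (@dual_continuous t))
    (dual_addD s t) (dual_add1 s t).

Lemma dual_oppD (s : dual) g h : (s (g + h))^* = (s g)^* * (s h)^*.
Proof. by rewrite dualD rmorphM. Qed.

Lemma dual_opp1 (s : dual) g : `|(s g)^*| = 1.
Proof. by rewrite conjc_norm dual_norm1. Qed.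

Definition dual_opp (s : dual) : dual :=
  MkDual (continuous_conjc (@dual_continuous s)) (dual_oppD s) (dual_opp1 s).

Lemma dual_zeroD (g h : G) : 1 = 1 * 1 :> R[i]. Proof. by rewrite mulr1. Qed.

Definition dual_zero : dual :=
  MkDual (fun=> @cst_continuous _ R[i]^o 1 _) dual_zeroD (fun=> normr1 R[i]).

Lemma dual_addA : associative dual_add.
Proof. by move=> s t u; apply: dual_eq => g /=; rewrite mulrA. Qed.

Lemma dual_addC : commutative dual_add.
Proof. by move=> s t; apply: dual_eq => g /=; rewrite mulrC. Qed.

Lemma dual_add0 : left_id dual_zero dual_add.
Proof. by move=> s; apply: dual_eq => g /=; rewrite mul1r. Qed.

Lemma dual_addN : left_inverse dual_zero dual_opp dual_add.
Proof.
move=> s; apply: dual_eq => g /=.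
have := dual_norm1 s g; rewrite -[`|_|]nrmC nrmE => -[].
case: (s g) => a b /= /(congr1 (fun x => x ^+ 2)).
rewrite sqr_sqrtr ?addr_ge0 ?sqr_ge0// expr1n => ab.
by rewrite -[LHS]/((a * a - - b * b) +i* (a * b + - b * a)) mulNr opprK -!expr2 ab
  mulNr (mulrC b) subrr.
Qed.

HB.instance Definition _ :=
  GRing.isZmodule.Build dual dual_addA dual_addC dual_add0 dual_addN.

Definition dual_incl (s : dual) : {compact-open, G -> R[i]^o} := dual_fun s.

HB.instance Definition _ := Topological.copy dual (initial_topology dual_incl).

Lemma dual_cvgP (s : dual) (F : set_system dual) : Filter F ->
  F --> s <-> forall K, compact K -> forall e : R, 0 < e ->
    \forall t \near F, (forall g, K g -> nrm (s g - (t : dual) g) < e).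
Proof.
move=> FF.
have -> : F --> s <-> {compact-open, dual_incl @ F --> dual_incl s}.
  split=> [Fs|Fs A].
    exact: (cvg_comp _ _ Fs (@initial_continuous _ _ dual_incl s)).
  move=> /= [_ [[B oB <-] Bs BA]].
  have FB : F (dual_incl @^-1` B) by apply: Fs; exact: open_nbhs_nbhs.
  exact: filterS BA FB.
rewrite compact_open_fam_compactP; last exact: dual_continuous.
rewrite fam_cvgP; split=> h K cK.
  move=> e e0; have eC0 : 0 < e%:C by rewrite ltcR.
  have eE : entourage [set xy : R[i]^o * R[i]^o | ball xy.1 e%:C xy.2].
    by rewrite -entourage_ballE; exists e%:C.
  have : nbhs (dual_incl s : {uniform` K -> R[i]^o})
      [set t | forall g, K g -> `|s g - t g| < e%:C].
    by apply/uniform_nbhs; eexists; split; [exact: eE|].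
  move=> /(h K cK) FB.
  have {}FB : F [set t : dual | forall g, K g -> `|s g - t g| < e%:C] := FB.
  apply: filterS FB => t /= st g Kg.
  by rewrite -ltcR nrmC; exact: st.
move=> P /uniform_nbhs[E []]; rewrite -entourage_ballE => -[e /= e0 eE EP].
have eR : e = (complex.Re e)%:C.
  by case: e e0 {eE} => a b; rewrite ltcE /= => /andP[/eqP -> _].
have {}e0 : 0 < complex.Re e by rewrite -ltcR -eR.
have FB := h K cK _ e0.
suff : F (dual_incl @^-1` P) by [].
apply: filterS FB => t st; apply: EP => g Kg; apply: eE => /=.
suff : `|s g - t g| < e by [].
by rewrite eR -nrmC ltcR; exact: st.
Qed.

Lemma dual_sub_continuous : continuous (fun st : dual * dual => st.1 - st.2).
Proof.
move=> [s t]; apply/dual_cvgP => K cK e e0.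
have e20 : 0 < e / 2 by rewrite divr_gt0.
have [/(_ (@cvg_id _ _) K cK _ e20) hs _] := dual_cvgP s (@nbhs_filter _ s).
have [/(_ (@cvg_id _ _) K cK _ e20) ht _] := dual_cvgP t (@nbhs_filter _ t).
exists ([set s' : dual | forall g, K g -> nrm (s g - s' g) < e / 2],
        [set t' : dual | forall g, K g -> nrm (t g - t' g) < e / 2]) => //.
move=> [s' t'] [/= hs' ht'] g Kg.
rewrite (_ : _ - _ = (s g - s' g) * (t g)^* + s' g * ((t g)^* - (t' g)^*)); last first.
  by rewrite mulrBl mulrBr addrA subrK.
rewrite (le_lt_trans (ler_nrmD _ _))// !nrmM [X in _ < X](splitr e).
have n1 (u : dual) : nrm (u g) = 1 by rewrite /nrm dual_norm1.
by rewrite ltrD//; rewrite /nrm ?conjc_norm ?conjc_sub_norm -!/(nrm _) n1 ?mulr1 ?mul1r; [exact: hs'|exact: ht'].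
Qed.

HB.instance Definition _ :=
  PreTopologicalNmodule_isTopologicalZmodule.Build dual dual_sub_continuous.
End dual.

(* The class of f in L^p; by convention 0 if f is not in L^p. *)
Definition Lp_class d (X : measurableType d) (R : realType)
    (mu : {measure set X -> \bar R}) (p : R) (p1 : 1 <= p) (f : X -> R[i]) :
    Lp mu p1 :=
  Lp_pi (insubd 0 f).

Section operators.
Context (R : realType).

Definition opnorm (V W : normedModType R[i]) (T : V -> W) : \bar R :=
  ereal_sup [set (nrm (T x))%:E | x in [set x : V | nrm x <= 1]].

Definition bounded_operator (V W : normedModType R[i]) (T : V -> W) : Prop :=
  linear T /\ continuous T.

Definition separable (T : topologicalType) : Prop :=
  exists2 S : set T, countable S & dense S.

End operators.

(* Banach algebras without unit: the rings of the library are unital, whence a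
   separate multiplication bmul. *)
HB.mixin Record isBanachAlgebra (K : numFieldType) T
    & CompleteNormedModule K T := {
  bmul : T -> T -> T ;
  bmulA : associative bmul ;
  bmulDl : left_distributive bmul +%R ;
  bmulDr : right_distributive bmul +%R ;
  bscalerAl : forall (a : K) x y, bmul (a *: x) y = a *: bmul x y ;
  bscalerAr : forall (a : K) x y, bmul x (a *: y) = a *: bmul x y ;
  ler_bnormM : forall x y, `|bmul x y| <= `|x| * `|y| }.

#[short(type="banachAlgType")]
HB.structure Definition BanachAlgebra (K : numFieldType) :=
  {T of CompleteNormedModule K T & isBanachAlgebra K T}.

(* Bochner integral. A step function is given by a list of pairs (E, v), with E
   measurable of finite measure, and stands for the sum of the v * 1_E. *)
Section bochner.
Context d (T : measurableType d) (R : realType).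
Context (mu : {measure set T -> \bar R}) (V : normedModType R[i]).

Definition is_step (s : seq (set T * V)) : Prop :=
  forall q, q \in s -> measurable q.1 /\ (mu q.1 < +oo)%E.

Definition step (s : seq (set T * V)) (x : T) : V :=
  \sum_(q <- s) (\1_(q.1) x : R[i]) *: q.2.

Definition step_integral (s : seq (set T * V)) : V :=
  \sum_(q <- s) (fine (mu q.1))%:C *: q.2.

Definition is_bochner (f : T -> V) (v : V) : Prop :=
  exists s_ : nat -> seq (set T * V),
    [/\ forall n, is_step (s_ n),
        forall x, step (s_ n) x @[n --> \oo] --> f x,
        (\int[mu]_x (nrm (f x - step (s_ n) x))%:E)%E @[n --> \oo] --> 0%E
      & step_integral (s_ n) @[n --> \oo] --> v].

(* By convention 0 if f is not Bochner integrable. *)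
Definition bochner (f : T -> V) : V := xget 0 [set v | is_bochner f v].

End bochner.

Section action.
Context (R : realType) (H : topologicalZmodType) (B : banachAlgType R[i]).

(* By [action0] and [actionD], each beta h is bijective with continuous inverse
   beta (- h). *)
Record is_action (beta : H -> B -> B) : Prop := {
  action_linear : forall h, linear (beta h) ;
  action_mul : forall h, {morph beta h : x y / bmul x y} ;
  action_continuous : forall h, continuous (beta h) ;
  action0 : forall b, beta 0 b = b ;
  actionD : forall h k b, beta (h + k) b = beta h (beta k b) ;
  action_orbit_continuous : forall b, continuous (beta^~ b) }.

Definition isometric_action (beta : H -> B -> B) : Prop :=
  is_action beta /\ forall h b, `|beta h b| = `|b|.

End action.

Section representations.
Context (R : realType) (p : R) (p1 : 1 <= p) (A : banachAlgType R[i]).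

Section on_X.
Context d (X : measurableType d) (mu : {measure set X -> \bar R}).
Local Notation E := (Lp mu p1).

Record is_representation (pi : A -> E -> E) : Prop := {
  rep_bounded : forall a, bounded_operator (pi a) ;
  rep_linear : forall xi, linear (pi^~ xi) ;
  rep_mul : forall a b xi, pi (bmul a b) xi = pi a (pi b xi) ;
  rep_continuous : forall a, opnorm (pi b \- pi a) @[b --> a] --> 0%E }.

Definition contractive (pi : A -> E -> E) : Prop :=
  forall a, (opnorm (pi a) <= (nrm a)%:E)%E.

Definition isometric (pi : A -> E -> E) : Prop :=
  forall a, opnorm (pi a) = (nrm a)%:E.

(* No scalars are needed in the span, as pi is linear. *)
Definition nondegenerate (pi : A -> E -> E) : Prop :=
  dense [set eta | exists s : seq (A * E), eta = \sum_(q <- s) pi q.1 q.2].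

(* The image of pi is closed in the algebra of bounded operators for the
   operator norm. *)
Definition closed_range (pi : A -> E -> E) : Prop :=
  forall T : E -> E, bounded_operator T ->
    (forall e : R, 0 < e -> exists a, (opnorm (pi a \- T)%R < e%:E)%E) ->
    exists a, pi a = T.

End on_X.

Definition is_Lp_operator_algebra : Prop :=
  exists d (X : measurableType d) (mu : {measure set X -> \bar R})
    (pi : A -> Lp mu p1 -> Lp mu p1),
    [/\ is_representation pi, isometric pi & closed_range pi].

Definition nondegenerately_representable : Prop :=
  exists d (X : measurableType d) (mu : {measure set X -> \bar R})
    (pi : A -> Lp mu p1 -> Lp mu p1),
    [/\ is_representation pi, isometric pi & nondegenerate pi].

End representations.

Section Cc.
Context (R : realType) (G : topologicalType) (V : normedModType R[i]).

Definition is_Cc : {pred G -> V} :=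
  mem [set f : G -> V | continuous f /\
    exists2 K, compact K & forall g, ~ K g -> f g = 0].

Lemma Cc_submod_closed : submod_closed is_Cc.
Proof.
split.
  rewrite inE; split; first exact: cst_continuous.
  by exists set0 => //; exact: compact0.
move=> c f g; rewrite !inE /= => -[cf [K cK fK]] [cg [L cL gL]]; split.
  move=> x; apply: cvgD; last exact: cg.
  by apply: cvgZr; exact: cf.
exists (K `|` L); first exact: compactU.
move=> x /not_orP[Kx Lx].
by rewrite !fctE fK// gL// scaler0 addr0.
Qed.

HB.instance Definition _ := GRing.isSubmodClosed.Build R[i] (G -> V) is_Cc
  Cc_submod_closed.

Record Cc := MkCc { Cc_fun :> G -> V ; CcP : Cc_fun \in is_Cc }.

HB.instance Definition _ := [isSub for Cc_fun].
HB.instance Definition _ := [Choice of Cc by <:].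
HB.instance Definition _ := [SubChoice_isSubLmodule of Cc by <:].

End Cc.

Section haar.
Context (R : realType) (G : topologicalZmodType).

(* Measurable types are required to be pointed. *)
Definition pointed0 : Type := G.
HB.instance Definition _ := Choice.on pointed0.
HB.instance Definition _ := isPointed.Build pointed0 (0 : G).

Definition borel : Type := g_sigma_algebraType (@open G : set (set pointed0)).
HB.instance Definition _ := Measurable.on borel.

(* G being abelian, left and right Haar measures coincide. *)
Record is_haar (nu : {measure set borel -> \bar R}) : Prop := {
  haar_neq0 : nu setT != 0%E ;
  haar_compact : forall K : set G, compact K -> (nu K < +oo)%E ;
  haar_outer : forall B : set borel, measurable B ->
    nu B = ereal_inf [set nu U | U in [set U : set G | open U /\ B `<=` U]] ;
  haar_inner : forall U : set G, open U ->
    nu U = ereal_sup [set nu K | K in [set K : set G | compact K /\ K `<=` U]] ;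
  haar_invariant : forall (g : G) (B : set borel), measurable B ->
    nu [set g + h | h in (B : set G)] = nu B }.

End haar.

Section crossed_product.
Context (R : realType) (p : R) (p1 : 1 <= p).
Context (G : topologicalZmodType) (nu : {measure set (borel G) -> \bar R}).
Context (A : banachAlgType R[i]) (alpha : G -> A -> A).

(* In additive notation h^-1 g is g - h. *)
Definition convolution_fun (a b : G -> A) (g : G) : A :=
  bochner nu (fun h => bmul (a h) (alpha h (b (g - h)))).

(* The convolution of two elements of C_c(G, A) is in C_c(G, A), so that the
   default value 0 of insubd is irrelevant. *)
Definition convolution (a b : Cc G A) : Cc G A :=
  insubd 0 (convolution_fun a b).

Section regular.
Context d (X : measurableType d) (mu : {sigma_finite_measure set X -> \bar R}).
Local Notation E := (Lp mu p1).
Local Notation EG := (Lp (nu \x mu)%E p1).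

Definition translation (g : G) (xi : EG) : EG :=
  Lp_class (nu \x mu)%E p1 (fun z : borel G * X => Lp_fun xi ((z.1 : G) - g, z.2)).

(* xi in L^p(G * X) is the element identified with f : G -> L^p(X): for almost
   all h, the section xi(h, _) belongs to the class f h. *)
Definition is_field_of (xi : EG) (f : G -> E) : Prop :=
  {ae nu, forall h, {ae mu, forall x, Lp_fun xi (h, x) = Lp_fun (f h) x}}.

(* pi (together with [translation]) is the regular covariant representation
   associated with pi0. The formula for pi a on the dense subspace C_c(G, L^p(X))
   defines there an operator of norm at most |a|, and pi a is its extension by
   continuity, whence [regular_contractive]. *)
Record is_regular (pi0 : A -> E -> E) (pi : A -> EG -> EG) : Prop := {
  regular_rep : is_representation pi ;
  regular_contractive : contractive pi ;
  regularE : forall a (f : Cc G E) (xi : EG), is_field_of xi f ->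
    is_field_of (pi a xi) (fun h => pi0 (alpha (- h) a) (f h)) }.

(* The operator (v |x pi)(a) xi = int_G pi(a(g)) v_g xi dnu(g). *)
Definition integrated_form (pi : A -> EG -> EG) (a : Cc G A) (xi : EG) : EG :=
  bochner nu (fun g => pi (a g) (translation g xi)).

End regular.

(* Only sigma-finite mu occur, as required also by the product measure \x. *)
Definition reduced_norm (a : Cc G A) : \bar R :=
  ereal_sup [set r | exists d (X : measurableType d)
    (mu : {sigma_finite_measure set X -> \bar R})
    (pi0 : A -> Lp mu p1 -> Lp mu p1)
    (pi : A -> Lp (nu \x mu)%E p1 -> Lp (nu \x mu)%E p1),
    [/\ is_representation pi0, contractive pi0, nondegenerate pi0,
        is_regular pi0 pi & r = opnorm (integrated_form pi a)]].

(* F with iota is the Hausdorff completion of C_c(G, A) for [reduced_norm]: F is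
   complete, iota has dense range and pulls the norm of F back to the seminorm.
   This determines F up to a unique isometric isomorphism. *)
Record is_reduced_crossed_product (F : banachAlgType R[i])
    (iota : {linear Cc G A -> F}) : Prop := {
  crossed_mul : forall a b, iota (convolution a b) = bmul (iota a) (iota b) ;
  crossed_norm : forall a, (nrm (iota a))%:E = reduced_norm a ;
  crossed_dense : dense (range iota) }.

Lemma dual_act_Cc (tau : dual R G) (a : Cc G A) :
  (fun g => (tau g)^* *: a g) \in @is_Cc R G A.
Proof.
have := CcP a; rewrite !inE => -[ca [K cK aK]]; split.
  move=> g; apply: cvgZ; last exact: ca.
  exact: (@continuous_conjc R G tau (@dual_continuous _ _ tau) g).
by exists K => // g Kg; rewrite aK// scaler0.
Qed.

Definition dual_act (tau : dual R G) (a : Cc G A) : Cc G A :=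
  MkCc (dual_act_Cc tau a).

End crossed_product.

(* Main.v *)
(* Multiplication by a character s on L^p(G * X) is an invertible isometry u_s
   with u_s v_g = s(g) v_g u_s, and u_s pi u_(-s) is again a regular
   representation associated with the same pi0, because the defining formula of
   pi acts fibrewise over G. Hence the family of regular representations is
   stable under this conjugation, which turns the integrated form of a into that
   of its twist by s, so the dual action preserves the reduced norm and extends
   from C_c(G, A) to its completion. Continuity of the orbits follows from the
   estimate e * nu(K) for the reduced norm of a function supported in K and
   bounded by e. *)
Require Import Defs.
From HB Require Import structures.
From mathcomp Require Import all_boot all_order all_algebra.
From mathcomp Require Import all_classical all_reals all_analysis.
From mathcomp Require Import measurable_realfun complex ring.

Set Implicit Arguments.
Unset Strict Implicit.
Unset Printing Implicit Defensive.

Import Order.TTheory GRing.Theory Num.Theory.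
Import numFieldNormedType.Exports.

Local Open Scope classical_set_scope.
Local Open Scope complex_scope.
Local Open Scope ring_scope.

(** * Convergence and continuity in terms of the real-valued norm [nrm] *)

Section nrm_topology.
Context (R : realType) (V : normedModType R[i]).
Implicit Types (u v : V) (e : R).

Lemma nrmN v : nrm (- v) = nrm v.
Proof. by rewrite /nrm normrN. Qed.

Lemma nrm_distC u v : nrm (u - v) = nrm (v - u).
Proof. by rewrite -nrmN opprB. Qed.

Lemma nrm_ball v e : 0 < e -> nbhs v [set u | nrm (v - u) < e].
Proof.
move=> e0; apply/nbhs_normP; exists e%:C; first by rewrite /= ltcR.
by move=> u /=; rewrite -nrmC ltcR.
Qed.

(** Positive elements of [R[i]] are real, so the epsilons of the complex-valued norm may be taken in
    [R]. *)
Lemma nrm_cvgP (I : Type) (Q : set_system I) (FQ : Filter Q) (f : I -> V) v :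
  f i @[i --> Q] --> v <->
  forall e, 0 < e -> \forall i \near Q, nrm (v - f i) < e.
Proof.
split=> [/cvgrPdist_lt fv e e0|fv].
  have eC0 : 0 < e%:C by rewrite ltcR.
  by apply: filterS (fv _ eC0) => i /=; rewrite -nrmC ltcR.
apply/cvgrPdist_lt => e e0.
have eR : e = (complex.Re e)%:C.
  by case: e e0 => a b; rewrite ltcE /= => /andP[/eqP ->].
have {}e0 : 0 < complex.Re e by rewrite -ltcR -eR.
by apply: filterS (fv _ e0) => i /=; rewrite eR -nrmC ltcR.
Qed.

Lemma ler_nrm_dist u v : `|nrm u - nrm v| <= nrm (u - v).
Proof.
have h (a b : V) : nrm a - nrm b <= nrm (a - b).
  by rewrite lerBlDr (le_trans _ (ler_nrmD _ _))// subrK.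
by rewrite ler_norml lerNl opprB h nrm_distC h.
Qed.

Lemma cvg_nrm (I : Type) (Q : set_system I) (FQ : Filter Q) (f : I -> V) v :
  f i @[i --> Q] --> v -> nrm (f i) @[i --> Q] --> nrm v.
Proof.
move=> /nrm_cvgP fv; apply/cvgrPdist_lt => e e0.
by apply: filterS (fv _ e0) => i; apply: le_lt_trans; exact: ler_nrm_dist.
Qed.

End nrm_topology.

(** * Step functions with values in a normed space, and their integrals *)

Section step_functions.
Context d (T : measurableType d) (R : realType).
Context (mu : {measure set T -> \bar R}) (V : normedModType R[i]).
Implicit Types (s t : seq (set T * V)) (f g : T -> V) (D : set T) (v w : V).

Lemma step_cons (E : set T) v s x :
  step ((E, v) :: s) x = (\1_E x : R[i]) *: v + step s x.
Proof. by rewrite /step big_cons. Qed.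

Lemma is_step_cons (E : set T) v s : is_step mu ((E, v) :: s) ->
  [/\ measurable E, (mu E < +oo)%E & is_step mu s].
Proof.
move=> h; have [|? ?] := h (E, v); first by rewrite mem_head.
by split=> // q qs; apply: h; rewrite in_cons qs orbT.
Qed.

Lemma step_on D (E : set T) v w s x : (D `&` E) x ->
  w + step ((E, v) :: s) x = (w + v) + step s x.
Proof. by move=> [_ Ex]; rewrite step_cons indicE mem_set// scale1r addrA. Qed.

Lemma step_off D (E : set T) v w s x : (D `\` E) x ->
  w + step ((E, v) :: s) x = w + step s x.
Proof. by move=> [_ Ex]; rewrite step_cons indicE memNset// scale0r add0r. Qed.

(** [V] carries no sigma-algebra, so measurability concerns the norm only. Inside the first set of
    the list its value joins the constant [v], outside it drops out; hence the induction over all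
    [v] and [D]. *)
Lemma measurable_nrm_step s D v : is_step mu s -> measurable D ->
  measurable_fun D (fun x => nrm (v + step s x)).
Proof.
elim: s D v => [|[E w] s ih] D v ss mD.
  by under eq_fun do rewrite /step big_nil; exact: measurable_cst.
have [mE _ {}ss] := is_step_cons ss.
rewrite -(setUIDK D E); apply/measurable_funU.
- exact: measurableI.
- exact: measurableD.
split.
- apply: eq_measurable_fun (ih _ (v + w) ss _); last exact: measurableI.
  by move=> x /set_mem DE; rewrite (step_on _ _ _ DE).
- apply: eq_measurable_fun (ih _ v ss _); last exact: measurableD.
  by move=> x /set_mem DE; rewrite (step_off _ _ _ DE).
Qed.

(* Splitting D along the first set of the list reduces to two shorter lists on
   disjoint domains. *)
Lemma step_integral_ler_in s D v : is_step mu s -> measurable D ->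
  (mu D < +oo)%E ->
  ((nrm ((fine (mu D))%:C *: v +
         \sum_(q <- s) (fine (mu (D `&` q.1)))%:C *: q.2))%:E <=
    \int[mu]_(x in D) (nrm (v + step s x))%:E)%E.
Proof.
elim: s D v => [|[E w] s ih] D v ss mD fD.
  under eq_integral do rewrite /step big_nil.
  rewrite big_nil !addr0 integral_cst// nrmZ EFinM muleC nrmE/= expr0n/= addr0.
  by rewrite sqrtr_sqr ger0_norm ?fine_ge0// fineK// ge0_fin_numE.
have [mE _ ss'] := is_step_cons ss.
have mDE : measurable (D `&` E) by exact: measurableI.
have mDC : measurable (D `\` E) by exact: measurableD.
have fDE : (mu (D `&` E) < +oo)%E.
  by rewrite (le_lt_trans _ fD)// le_measure ?inE// => x [].
have fDC : (mu (D `\` E) < +oo)%E.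
  by rewrite (le_lt_trans _ fD)// le_measure ?inE// => x [].
have split_mu (B : set T) : measurable B ->
    fine (mu (D `&` B)) = fine (mu (D `&` E `&` B)) + fine (mu ((D `\` E) `&` B)).
  move=> mB; rewrite -fineD ?ge0_fin_numE//.
  - congr fine; rewrite -[in LHS](setUIDK D E) setIUl measureU//.
    + exact: measurableI.
    + exact: measurableI.
    + by rewrite -subset0 => x [[[_ ?] _] [[_ ?] _]].
  - by rewrite (le_lt_trans _ fDE)// le_measure ?inE//; first exact: measurableI.
  - by rewrite (le_lt_trans _ fDC)// le_measure ?inE//; first exact: measurableI.
rewrite -[X in (\int[mu]_(x in X) _)%E](setUIDK D E) ge0_integral_setU//.
- rewrite (eq_integral (fun x => (nrm ((v + w) + step s x))%:E)); last first.
    by move=> x /set_mem DE; rewrite (step_on _ _ _ DE).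
  rewrite [X in (_ <= _ + X)%E](eq_integral (fun x => (nrm (v + step s x))%:E)); last first.
    by move=> x /set_mem DE; rewrite (step_off _ _ _ DE).
  (* The two induction hypotheses, with constant [v + w] inside [E] and [v] outside, are merged by
     the triangle inequality. *)
  apply: le_trans (leeD (ih _ (v + w) ss' mDE fDE) (ih _ v ss' mDC fDC)).
  rewrite -EFinD lee_fin (le_trans _ (ler_nrmD _ _))// le_eqVlt; apply/orP; left.
  apply/eqP; congr nrm; rewrite big_cons/=.
  have := split_mu _ measurableT; rewrite !setIT => ->.
  rewrite (eq_big_seq (fun q => (fine (mu (D `&` E `&` q.1)))%:C *: q.2 +
     (fine (mu ((D `\` E) `&` q.1)))%:C *: q.2)); last first.
    by move=> q /ss'[mq _]; rewrite split_mu// rmorphD scalerDl.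
  rewrite big_split/= rmorphD scalerDl scalerDr addrACA !addrA; congr (_ + _).
  exact: addrAC.
- rewrite setUIDK; apply/measurable_EFinP; exact: measurable_nrm_step.
- by move=> x _; rewrite lee_fin nrm_ge0.
- by apply/disj_set2P; rewrite -subset0 => x [[_ ?] [_ ?]].
Qed.

Lemma step_integral_ler s : is_step mu s ->
  ((nrm (step_integral mu s))%:E <= \int[mu]_x (nrm (step s x))%:E)%E.
Proof.
move=> ss.
(* [D] has finite measure and contains every set of the list, so the bound on [D] with constant 0
   covers the whole step function. *)
have [D [mD fD sD]] : exists D, [/\ measurable D, (mu D < +oo)%E &
    forall q, q \in s -> q.1 `<=` D].
  elim: s ss => [|[E w] s ih] ss.
    by exists set0; split=> //; rewrite measure0.
  have [mE fE /ih[D [mD fD sD]]] := is_step_cons ss.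
  exists (E `|` D); split; first exact: measurableU.
    by rewrite (le_lt_trans (measureU2 _ _ _))// lte_add_pinfty.
  move=> q; rewrite in_cons => /orP[/eqP -> x|/sD qD x /qD]; by [left|right].
have := step_integral_ler_in 0 ss mD fD; rewrite scaler0 add0r.
rewrite (eq_big_seq (fun q => (fine (mu q.1))%:C *: q.2)); last first.
  by move=> q qs; rewrite setIC; move/setIidl: (sD _ qs) => ->.
move/le_trans; apply.
under eq_integral do rewrite add0r.
apply: ge0_subset_integral => //.
  apply/measurable_EFinP; under eq_fun do rewrite -[step _ _]add0r.
  exact: measurable_nrm_step.
by move=> x _; rewrite lee_fin nrm_ge0.
Qed.

Lemma step_cat s t x : step (s ++ t) x = step s x + step t x.
Proof. by rewrite /step big_cat. Qed.

Lemma step_integral_cat s t :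
  step_integral mu (s ++ t) = step_integral mu s + step_integral mu t.
Proof. by rewrite /step_integral big_cat. Qed.

Lemma is_step_cat s t : is_step mu s -> is_step mu t -> is_step mu (s ++ t).
Proof. by move=> ss st q; rewrite mem_cat => /orP[/ss|/st]. Qed.

End step_functions.

(** * Images of step functions under linear maps *)

Section step_map.
Context d (T : measurableType d) (R : realType).
Context (mu : {measure set T -> \bar R}) (V W : normedModType R[i]).
Context (u : {linear V -> W}).

Definition step_map (s : seq (set T * V)) := [seq (q.1, u q.2) | q <- s].

Lemma step_mapE s x : step (step_map s) x = u (step s x).
Proof.
rewrite /step/step_map big_map linear_sum; apply: eq_bigr => q _.
by rewrite linearZ.
Qed.

Lemma step_integral_map s : step_integral mu (step_map s) = u (step_integral mu s).
Proof.
rewrite /step_integral/step_map big_map linear_sum; apply: eq_bigr => q _.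
by rewrite linearZ.
Qed.

Lemma is_step_map s : is_step mu s -> is_step mu (step_map s).
Proof. by move=> ss q /mapP[r /ss[? ?] ->]. Qed.

(** An isometry carries approximating step functions of [f] to ones of [u \o f] and preserves the
    norms of all errors. *)
Lemma is_bochner_isometry (f : T -> V) v : (forall x, nrm (u x) = nrm x) ->
  is_bochner mu f v -> is_bochner mu (u \o f) (u v).
Proof.
move=> u_iso [s_ [ss sf sI sv]].
have cu (Q : set_system nat) (FQ : Filter Q) (h : nat -> V) w :
    h n @[n --> Q] --> w -> u (h n) @[n --> Q] --> u w.
  move=> /nrm_cvgP hw; apply/nrm_cvgP => e /hw.
  by apply: filterS => n; rewrite -linearB u_iso.
exists (fun n => step_map (s_ n)); split.
- by move=> n; exact: is_step_map.
- by move=> x; under eq_fun do rewrite step_mapE; exact: cu.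
- under eq_fun do under eq_integral do rewrite step_mapE /= -linearB u_iso.
  exact: sI.
- by under eq_fun do rewrite step_integral_map; exact: cu.
Qed.

End step_map.

(** * The Bochner integral: norm bound, uniqueness, compatibility with isometries *)

Section bochner_integral.
Context d (T : measurableType d) (R : realType).
Context (mu : {measure set T -> \bar R}) (V : normedModType R[i]).
Implicit Types (s t : seq (set T * V)) (f g : T -> V) (v w : V).

Let opp_step : seq (set T * V) -> seq (set T * V) := step_map (@GRing.opp V).

(** The function is a pointwise limit of norms of step functions, the list for each difference being
    a concatenation with the negated [t]. *)
Lemma measurable_nrm_lim (s_ : nat -> seq (set T * V)) f t :
  (forall n, is_step mu (s_ n)) -> (forall x, step (s_ n) x @[n --> \oo] --> f x) ->
  is_step mu t -> measurable_fun setT (fun x => nrm (f x - step t x)).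
Proof.
move=> ss sf st.
apply: (@measurable_realfun.measurable_fun_cvg _ _ _ _ (fun n x => nrm (step (s_ n) x - step t x))).
  move=> n.
  have sn : is_step mu (s_ n ++ opp_step t).
    by apply: is_step_cat => //; exact: is_step_map.
  apply: eq_measurable_fun (measurable_nrm_step 0 sn measurableT) => x _.
  by rewrite step_cat step_mapE add0r.
by move=> x _; apply: cvg_nrm; apply: cvgB; [exact: sf|exact: cvg_cst].
Qed.

Lemma is_bochner_measurable f v : is_bochner mu f v ->
  measurable_fun setT (fun x => nrm (f x)).
Proof.
move=> [s_ [ss sf _ _]].
have /(measurable_nrm_lim ss sf) : is_step mu ([::] : seq (set T * V)) by [].
by under eq_fun do rewrite /step big_nil subr0.
Qed.

(** Concatenating the lists for [f] with the negated lists for [g] gives approximations whose error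
    is at most the sum of the two errors. *)
Lemma is_bochnerB f g v w : is_bochner mu f v -> is_bochner mu g w ->
  is_bochner mu (f \- g) (v - w).
Proof.
move=> [s_ [ss sf sI sv]] [t_ [tt tg tI tw]].
exists (fun n => s_ n ++ opp_step (t_ n)); split.
- by move=> n; apply: is_step_cat => //; exact: is_step_map.
- move=> x; under eq_fun do rewrite step_cat step_mapE.
  by apply: cvgB; [exact: sf|exact: tg].
- have m1 n := measurable_nrm_lim ss sf (ss n).
  have m2 n := measurable_nrm_lim tt tg (tt n).
  have lim0 : (\int[mu]_x (nrm (f x - step (s_ n) x))%:E +
      \int[mu]_x (nrm (g x - step (t_ n) x))%:E)%E @[n --> \oo] --> 0%E.
    by rewrite -[X in _ --> X]adde0; exact: cvgeD.
  apply: (squeeze_cvge _ (cvg_cst _) lim0); apply: nearW => n.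
  apply/andP; split; first by apply: integral_ge0 => x _; rewrite lee_fin nrm_ge0.
  rewrite -ge0_integralD//; try (by move=> x _; rewrite lee_fin nrm_ge0);
    try exact/measurable_EFinP.
  apply: ge0_le_integral => //; try (by move=> x _; rewrite ?adde_ge0 ?lee_fin ?nrm_ge0).
  + apply/measurable_EFinP.
    apply: (@measurable_nrm_lim (fun n => s_ n ++ opp_step (t_ n)) (f \- g)).
    * by move=> m; apply: is_step_cat => //; exact: is_step_map.
    * move=> x; under eq_fun do rewrite step_cat step_mapE.
      by apply: cvgB; [exact: sf|exact: tg].
    * by apply: is_step_cat => //; exact: is_step_map.
  + by apply: emeasurable_funD; exact/measurable_EFinP.
  + move=> x _; rewrite step_cat step_mapE -EFinD lee_fin.
    rewrite (_ : _ - _ = (f x - step (s_ n) x) - (g x - step (t_ n) x)).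
      by rewrite (le_trans (ler_nrmD _ _))// nrmN.
    by rewrite /= !opprD !opprK addrACA.
- under eq_fun do rewrite step_integral_cat step_integral_map.
  exact: cvgB.
Qed.

(** Limit of the bound for step functions, since the norm of a step function is at most [nrm f] plus
    the approximation error. *)
Lemma is_bochner_ler f v : is_bochner mu f v ->
  ((nrm v)%:E <= \int[mu]_x (nrm (f x))%:E)%E.
Proof.
move=> bf; have mf := is_bochner_measurable bf.
case: bf => s_ [ss sf sI sv].
(* The integral of [nrm f] could a priori be infinite, but adding a term that tends to 0 is still
   well defined. *)
have limR : (\int[mu]_x (nrm (f x))%:E +
    \int[mu]_x (nrm (f x - step (s_ n) x))%:E)%E @[n --> \oo] -->
    (\int[mu]_x (nrm (f x))%:E)%E.
  rewrite -[X in _ --> X]adde0; apply: cvgeD => //; last exact: cvg_cst.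
  by rewrite /adde_def/= !andbF.
have limL : (nrm (step_integral mu (s_ n)))%:E @[n --> \oo] --> (nrm v)%:E.
  by apply: cvg_EFin; [exact: nearW|exact: cvg_nrm].
apply: (lee_cvg_to limL limR); apply: nearW => n.
apply: (le_trans (step_integral_ler (ss n))).
have m1 := measurable_nrm_lim ss sf (ss n).
rewrite -ge0_integralD//; try (by move=> x _; rewrite lee_fin nrm_ge0);
  try exact/measurable_EFinP.
apply: ge0_le_integral => //; try (by move=> x _; rewrite ?adde_ge0 ?lee_fin ?nrm_ge0).
- apply/measurable_EFinP; under eq_fun do rewrite -[step _ _]add0r.
  exact: measurable_nrm_step.
- by apply: emeasurable_funD; exact/measurable_EFinP.
- move=> x _; rewrite -EFinD lee_fin -[X in _ <= _ + X]nrmN opprB addrC.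
  by rewrite (le_trans _ (ler_nrmD _ _))// subrK.
Qed.

Lemma is_bochner_unique f v w : is_bochner mu f v -> is_bochner mu f w -> v = w.
Proof.
move=> fv fw; apply/subr0_eq/nrm_eq0/eqP.
rewrite eq_le nrm_ge0 andbT -lee_fin.
apply: (le_trans (is_bochner_ler (is_bochnerB fv fw))).
by rewrite integral0_eq// => x _; rewrite /= subrr nrm0.
Qed.

Lemma bochnerP f : (is_bochner mu f (bochner mu f)) \/
  (bochner mu f = 0 /\ forall v, ~ is_bochner mu f v).
Proof.
rewrite /bochner; case: xgetP => [v _ fv|h]; first by left.
by right; split=> // v; exact: h.
Qed.

Lemma bochnerE f v : is_bochner mu f v -> bochner mu f = v.
Proof.
by move=> fv; have [/is_bochner_unique/(_ fv)|[_ /(_ v)]] := bochnerP f.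
Qed.

End bochner_integral.

(** The inverse [w] takes care of the default value: it shows that [u \o f] is integrable only if
    [f] is, so that otherwise both sides are 0. *)
Lemma bochner_isometry d (T : measurableType d) (R : realType)
    (mu : {measure set T -> \bar R}) (V W : normedModType R[i])
    (u : {linear V -> W}) (w : {linear W -> V}) (f : T -> V) :
  (forall x, nrm (u x) = nrm x) -> cancel u w -> cancel w u ->
  bochner mu (u \o f) = u (bochner mu f).
Proof.
move=> u_iso uK wK.
have w_iso x : nrm (w x) = nrm x by rewrite -u_iso wK.
have [bf|[-> nf]] := bochnerP mu f; first exact/bochnerE/is_bochner_isometry.
have [/(is_bochner_isometry w_iso)|[-> _]] := bochnerP mu (u \o f); last by rewrite linear0.
rewrite (_ : w \o (u \o f) = f); first by move/nf.
by apply/funext => x /=; rewrite uK.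
Qed.

(** * Multiplication by unimodular functions on L^p *)

Section multiplier.
Context d (X : measurableType d) (R : realType).
Context (mu : {measure set X -> \bar R}) (p : R) (p1 : 1 <= p).
Local Notation E := (Lp mu p1).

Lemma nrm_Lp_pi (f : LpFun mu p1) : nrm (Lp_pi f : E) = fine (Lp_enorm mu p f).
Proof. exact: Lp_norm_pi. Qed.

Lemma Lp_enormE (f : X -> R[i]) :
  (Lp_enorm mu p f = (\int[mu]_x ((nrm (f x))%:E `^ p)) `^ p^-1)%E.
Proof.
rewrite /Lp_enorm unlock /Lnorm.
by under eq_integral do rewrite /= ger0_norm ?nrm_ge0//.
Qed.

Lemma measurable_nrm_powR (f : LpFun mu p1) :
  measurable_fun setT (fun x => ((nrm (f x))%:E `^ p)%E).
Proof.
apply: (@measurableT_comp _ _ _ _ _ _ (fun x => x `^ p)%E) => //=.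
  exact: measurable_poweR.
exact/measurable_EFinP/cmeasurable_nrm/LpFun_measurable.
Qed.

Lemma Lp_pi_scale (a : R[i]) (f : LpFun mu p1) :
  a *: (Lp_pi f : E) = Lp_pi (a *: f).
Proof. exact: Lp_piZ. Qed.

Lemma Lp_classE (f : LpFun mu p1) : Lp_class mu p1 f = Lp_pi f.
Proof. by rewrite /Lp_class valKd. Qed.

Lemma Lp_funE (f : LpFun mu p1) : {ae mu, forall x, Lp_fun (Lp_pi f) x = f x}.
Proof. exact: Lp_repr. Qed.

Lemma Lp_fun_scale (a : R[i]) (xi : E) :
  {ae mu, forall x, Lp_fun (a *: xi) x = a * Lp_fun xi x}.
Proof. exact: Lp_repr. Qed.

Lemma cmeasurableM (f g : X -> R[i]) :
  cmeasurable f -> cmeasurable g -> cmeasurable (fun x => f x * g x).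
Proof.
move=> [fr fi] [gr gi]; split.
  rewrite (_ : (fun _ => _) = (fun x => complex.Re (f x) * complex.Re (g x) -
      complex.Im (f x) * complex.Im (g x))).
    by apply: measurable_funB; exact: measurable_funM.
  by apply/funext => x; case: (f x); case: (g x).
rewrite (_ : (fun _ => _) = (fun x => complex.Re (f x) * complex.Im (g x) +
    complex.Im (f x) * complex.Re (g x))).
  by apply: measurable_funD; exact: measurable_funM.
by apply/funext => x; case: (f x); case: (g x).
Qed.

Section unimodular.
Context (c : X -> R[i]) (mc : cmeasurable c) (c1 : forall x, nrm (c x) = 1).

Lemma mul_is_Lp_fun (f : LpFun mu p1) : (fun x => c x * f x) \in is_Lp_fun mu p1.
Proof.
have := LpFunP f; rewrite !inE => -[mf nf]; split; first exact: cmeasurableM.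
by under eq_fun do rewrite nrmM c1 mul1r.
Qed.

Definition mul_LpFun (f : LpFun mu p1) : LpFun mu p1 := MkLpFun (mul_is_Lp_fun f).

Definition mul_Lp (xi : E) : E := Lp_pi (mul_LpFun (repr xi)).

Lemma mul_Lp_pi (f : LpFun mu p1) : mul_Lp (Lp_pi f) = Lp_pi (mul_LpFun f).
Proof. by apply/Lp_piP; apply: filterS (Lp_repr f) => x /= ->. Qed.

Lemma Lp_fun_mul (xi : E) : {ae mu, forall x, Lp_fun (mul_Lp xi) x = c x * Lp_fun xi x}.
Proof. exact: Lp_funE. Qed.

Lemma mul_Lp_linear : linear mul_Lp.
Proof.
move=> a x y; rewrite -(Lp_piK x) -(Lp_piK y).
rewrite Lp_pi_scale -Lp_piD !mul_Lp_pi Lp_pi_scale -Lp_piD; congr Lp_pi.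
by apply/val_inj/funext => z /=; rewrite !fctE mulrDr; congr (_ + _); exact: mulrCA.
Qed.

HB.instance Definition _ := GRing.isLinear.Build _ _ _ _ mul_Lp mul_Lp_linear.

Lemma nrm_mul_Lp (xi : E) : nrm (mul_Lp xi) = nrm xi.
Proof.
rewrite -[in RHS](Lp_piK xi) !nrm_Lp_pi; congr (fine _).
by rewrite /Lp_enorm; under eq_fun do rewrite /= nrmM c1 mul1r.
Qed.

End unimodular.

Lemma mul_LpK (c c' : X -> R[i]) (mc : cmeasurable c) (mc' : cmeasurable c')
    (c1 : forall x, nrm (c x) = 1) (c1' : forall x, nrm (c' x) = 1) :
  (forall x, c x * c' x = 1) -> cancel (mul_Lp mc' c1') (mul_Lp mc c1).
Proof.
move=> cc' xi; rewrite -[in LHS](Lp_piK xi) !mul_Lp_pi -[RHS](Lp_piK xi).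
congr Lp_pi; apply/val_inj/funext => z /=.
by rewrite mulrA cc' mul1r.
Qed.

End multiplier.

(** * Borel sets of G, translations and characters on L^p of G times X *)

Section haar_product.
Context (R : realType) (G : topologicalZmodType).
Context (nu : {measure set (borel G) -> \bar R}) (nu_haar : is_haar nu).

Lemma open_borel (U : set G) : open U -> measurable (U : set (borel G)).
Proof. by move=> oU; apply: sub_sigma_algebra. Qed.

Lemma continuous_borel (f : G -> G) : continuous f ->
  measurable_fun setT (f : borel G -> borel G).
Proof.
move=> /continuousP cf.
apply: (@measurability _ _ (borel G) (borel G) setT f (@open G : set (set (borel G)))) => //.
by move=> _ [U oU <-]; rewrite setTI; apply: open_borel; exact: cf.
Qed.

(** Real and imaginary part are 1-Lipschitz for [nrm], so composed with [f] they are continuous;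
    preimages of open intervals, which generate the Borel sets of [R], are then open. *)
Lemma continuous_cmeasurable_borel (f : G -> R[i]) : continuous (f : G -> R[i]^o) ->
  cmeasurable (f : borel G -> R[i]).
Proof.
have h (q : R[i] -> R) : (forall z w, `|q z - q w| <= nrm (z - w)) ->
    continuous (f : G -> R[i]^o) -> measurable_fun setT (q \o f : borel G -> R).
  move=> qle cf; have /continuousP cqf : continuous (q \o f : G -> R).
    move=> g; apply/cvgrPdist_lt => e e0.
    have /nrm_cvgP/(_ e e0) := cf g.
    by apply: filterS => x; apply: le_lt_trans; exact: qle.
  apply: (measurability _ (RGenOpens.measurableE R)).
  move=> _ [_ [a [b ->] <-]]; rewrite setTI; apply: open_borel; apply: cqf.
  exact: interval_open.
move=> cf; split; apply: h => // -[a b] [c e]; rewrite nrmE/= -sqrtr_sqr ler_wsqrtr//.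
  by rewrite lerDl sqr_ge0.
by rewrite lerDr sqr_ge0.
Qed.

Lemma haar_shift (g : G) (B : set (borel G)) : measurable B ->
  nu ((fun h : G => h - g) @^-1` (B : set G)) = nu B.
Proof.
move=> mB; rewrite -(haar_invariant nu_haar g mB); congr (nu _).
apply/seteqP; split=> [h Bh|_ [h Bh <-]]; first by exists (h - g); rewrite // addrC subrK.
by rewrite /preimage/= addrAC subrr add0r.
Qed.

Section product.
Context d (X : measurableType d) (mu : {sigma_finite_measure set X -> \bar R}).
Context (p : R) (p1 : 1 <= p).
Local Notation EG := (Lp (nu \x mu)%E p1).

Definition subG (g : G) (h : borel G) : borel G := (h : G) - g.

Definition shift (g : G) (z : borel G * X) : borel G * X := (subG g z.1, z.2).

Lemma measurable_subG (g : G) : measurable_fun setT (subG g).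
Proof.
have cg : continuous (fun h : G => h - g).
  move=> h; apply: (@continuous2_cvg _ _ _ _ _ _ _ (fun=> g) (fun a b : G => a - b) h g).
  - exact: (@sub_continuous _ (h, g)).
  - exact: cvg_id.
  - exact: cvg_cst.
exact: continuous_borel cg.
Qed.

Lemma measurable_shift g : measurable_fun setT (shift g).
Proof.
apply/measurable_fun_pairP; split.
  exact: (measurableT_comp (measurable_subG g) measurable_fst).
exact: measurable_snd.
Qed.

(** The section of the preimage at [h] is the section of [B] at [h - g]. Its [mu]-measure is thus
    integrated against the image of [nu] under translation, which is [nu] by invariance. *)
Lemma product_shift g (B : set (borel G * X)) : measurable B ->
  (nu \x mu)%E (shift g @^-1` B) = (nu \x mu)%E B.
Proof.
move=> mB.
rewrite /product_measure1.
have mF := measurable_fun_xsection mu mB.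
transitivity (\int[pushforward nu (subG g)]_h
    (mu \o xsection B) h)%E.
  by rewrite (@ge0_integral_pushforward _ _ _ _ _ _ (measurable_subG g) nu setT).
apply: eq_measure_integral => [|? C mC _]; first exact: measurable_subG.
exact: haar_shift.
Qed.

Lemma integral_shift g (f : borel G * X -> \bar R) : measurable_fun setT f ->
  (forall z, 0 <= f z)%E ->
  (\int[(nu \x mu)%E]_z f (shift g z) = \int[(nu \x mu)%E]_z f z)%E.
Proof.
move=> mf f0.
pose m : {measure set (borel G * X) -> \bar R} := (nu \x mu)%E.
have f0' : {in setT, forall z, (0 <= f z)%E} by move=> z _; exact: f0.
have := @ge0_integral_pushforward _ _ _ _ R _ (measurable_shift g) m setT f measurableT mf f0'.
rewrite preimage_setT => <-.
apply: eq_measure_integral => [|? B mB _]; first exact: measurable_shift.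
exact: product_shift.
Qed.

Lemma ae_shift g (Q : borel G * X -> Prop) :
  {ae (nu \x mu)%E, forall z, Q z} -> {ae (nu \x mu)%E, forall z, Q (shift g z)}.
Proof.
move=> [N [mN N0 QN]]; exists (shift g @^-1` N); split.
- by rewrite -[_ @^-1` _]setTI; apply: (measurable_shift g).
- by rewrite -N0; exact: product_shift.
- by move=> z; exact: QN.
Qed.

(** The [mu]-measures of the sections of a null set integrate to 0 over G, so almost all sections
    are null. *)
Lemma ae_section (Q : borel G * X -> Prop) : {ae (nu \x mu)%E, forall z, Q z} ->
  {ae nu, forall h, {ae mu, forall x, Q (h, x)}}.
Proof.
move=> [N [mN N0 QN]].
have mF := measurable_fun_xsection mu mN.
have /(ae_eq_integral_abs nu measurableT mF) :
    (\int[nu]_x `|(mu \o xsection N) x| = 0)%E.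
  by rewrite -[RHS]N0; apply: eq_integral => x _; rewrite gee0_abs.
apply: filterS => h /(_ I) /= h0; exists (xsection N h); split => //.
  exact: measurable_xsection.
by move=> x nQ; rewrite /xsection/= inE; apply: QN.
Qed.

Lemma shift_is_Lp_fun g (f : LpFun (nu \x mu)%E p1) :
  (fun z => f (shift g z)) \in is_Lp_fun (nu \x mu)%E p1 /\
  Lp_enorm (nu \x mu)%E p (fun z => f (shift g z)) = Lp_enorm (nu \x mu)%E p f.
Proof.
have [mr mi] := LpFun_measurable f.
have mf : cmeasurable (fun z => f (shift g z)).
  split.
    exact: (measurableT_comp mr (measurable_shift g)).
  exact: (measurableT_comp mi (measurable_shift g)).
have fE : Lp_enorm (nu \x mu)%E p (fun z => f (shift g z)) = Lp_enorm (nu \x mu)%E p f.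
  have := integral_shift g (measurable_nrm_powR f) (fun z => poweR_ge0 _ p).
  by rewrite !Lp_enormE => ->.
split=> //; rewrite inE; split=> //.
by have := LpFunP f; rewrite inE => -[_]; rewrite /finite_norm -!/(Lp_enorm _ _ _) fE.
Qed.

Definition shift_LpFun g (f : LpFun (nu \x mu)%E p1) : LpFun (nu \x mu)%E p1 :=
  MkLpFun (shift_is_Lp_fun g f).1.

Lemma translationE g (xi : EG) : translation g xi = Lp_pi (shift_LpFun g (repr xi)).
Proof. exact: (Lp_classE (shift_LpFun g (repr xi))). Qed.

(** Translation is defined through a chosen representative; it respects equality almost everywhere
    because the shift preserves null sets. *)
Lemma translation_pi g (f : LpFun (nu \x mu)%E p1) :
  translation g (Lp_pi f) = Lp_pi (shift_LpFun g f).
Proof.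
rewrite translationE; apply/Lp_piP.
exact: (@ae_shift g (fun z => repr (Lp_pi f) z = f z) (Lp_repr f)).
Qed.

Lemma nrm_translation g (xi : EG) : nrm (translation g xi) = nrm xi.
Proof.
rewrite -(Lp_piK xi) translation_pi !nrm_Lp_pi; congr (fine _).
exact: (shift_is_Lp_fun g (repr xi)).2.
Qed.

Lemma nrm_dual (s : dual R G) g : nrm (s g) = 1.
Proof. by rewrite /nrm dual_norm1. Qed.

Lemma cmeasurable_dual (s : dual R G) : cmeasurable (fun z : borel G * X => s z.1).
Proof.
have [mr mi] := continuous_cmeasurable_borel (@dual_continuous _ _ s).
split.
  exact: (measurableT_comp mr measurable_fst).
exact: (measurableT_comp mi measurable_fst).
Qed.

Definition dual_mul (s : dual R G) : EG -> EG :=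
  mul_Lp (cmeasurable_dual s) (fun z => nrm_dual s z.1).

HB.instance Definition _ s := GRing.Linear.on (dual_mul s).

Lemma dual_mul_linear s : linear (dual_mul s).
Proof. exact: mul_Lp_linear. Qed.

Lemma dual_mulB s (x y : EG) : dual_mul s (x - y) = dual_mul s x - dual_mul s y.
Proof. exact: linearB. Qed.

Lemma dual_mulVK (s : dual R G) : cancel (dual_mul (- s)) (dual_mul s).
Proof.
apply: mul_LpK => z.
have -> : s z.1 * (- s) z.1 = (s - s) z.1 by [].
by rewrite subrr.
Qed.

Lemma dual_mulKV (s : dual R G) : cancel (dual_mul s) (dual_mul (- s)).
Proof. by move=> xi; have := dual_mulVK (- s) xi; rewrite opprK. Qed.

Lemma nrm_dual_mul (s : dual R G) xi : nrm (dual_mul s xi) = nrm xi.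
Proof. exact: nrm_mul_Lp. Qed.

(** This is s(h) = s(h - g) s(g), read at each point with first coordinate h. *)
Lemma dual_mul_translation (s : dual R G) g xi :
  dual_mul s (translation g xi) = s g *: translation g (dual_mul s xi).
Proof.
rewrite -(Lp_piK xi) translation_pi /dual_mul !mul_Lp_pi translation_pi.
rewrite Lp_pi_scale; congr Lp_pi; apply/val_inj/funext => z /=.
by rewrite !fctE/= -[in LHS](subrK g (z.1 : G)) dualD [s _ * s g]mulrC; exact/esym/mulrA.
Qed.

(** The pointwise product formula holds off a null set of G times X, hence almost everywhere on
    almost every fibre, where it combines with the description of [xi] by [f]. *)
Lemma dual_mul_field (s : dual R G) (xi : EG) (f : G -> Lp mu p1) :
  is_field_of xi f -> is_field_of (dual_mul s xi) (fun h => s h *: f h).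
Proof.
move=> xif.
have h := ae_section (Lp_fun_mul (cmeasurable_dual s) (fun z => nrm_dual s z.1) xi).
apply: filterS2 xif h => g xig hg.
apply: filterS3 xig hg (Lp_fun_scale (s g) (f g)) => x -> -> -> .
by [].
Qed.

End product.
End haar_product.

(** * Operator norms and isometries *)

Section operator_norm.
Context (R : realType) (V W : normedModType R[i]).
Implicit Types (T : V -> W).

Lemma linear_homZ T : linear T -> forall (c : R[i]) x, T (c *: x) = c *: T x.
Proof.
move=> lT c x; have T0 : T 0 = 0.
  by have /eqP := lT 1 0 0; rewrite !scale1r addr0 -subr_eq0 opprD addNKr oppr_eq0 => /eqP.
by have := lT c x 0; rewrite T0 !addr0.
Qed.

Lemma linear_homB T : linear T -> forall x y, T (x - y) = T x - T y.
Proof. by move=> lT x y; rewrite addrC -scaleN1r lT scaleN1r addrC. Qed.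

Lemma isometry_continuous T : linear T -> (forall x, nrm (T x) = nrm x) ->
  continuous T.
Proof.
move=> lT T_iso x; apply/nrm_cvgP => e e0.
by apply: filterS (nrm_ball x e0) => y; rewrite /= -linear_homB// T_iso.
Qed.

(** [w] maps the unit ball onto itself, with preimages given by [w'], so both suprema run over the
    same set of norms. *)
Lemma opnorm_conj (V' W' : normedModType R[i]) (u : W -> W') (w : V' -> V)
    (w' : V -> V') T :
  (forall y, nrm (u y) = nrm y) -> (forall x, nrm (w x) = nrm x) ->
  cancel w' w -> opnorm (fun x => u (T (w x))) = opnorm T.
Proof.
move=> u_iso w_iso wK; congr ereal_sup; apply/seteqP; split=> _ [x /= x1 <-].
  by exists (w x); rewrite /= ?w_iso ?u_iso.
by exists (w' x); [rewrite /= -w_iso wK|rewrite u_iso wK].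
Qed.

Lemma nrm_opnorm T (M : R) : linear T -> (opnorm T <= M%:E)%E ->
  forall x, nrm (T x) <= M * nrm x.
Proof.
move=> lT TM x; have [/nrm_eq0 ->|x0] := eqVneq (nrm x) 0.
  have := linear_homZ lT 0 0; rewrite !scale0r => ->.
  by rewrite !nrm0 mulr0.
have x_gt0 : 0 < nrm x by rewrite lt_neqAle eq_sym x0 nrm_ge0.
pose c : R[i] := ((nrm x)^-1)%:C.
have nc : nrm c = (nrm x)^-1.
  by rewrite nrmE/= expr0n/= addr0 sqrtr_sqr ger0_norm// invr_ge0 nrm_ge0.
have : ((nrm (T (c *: x)))%:E <= M%:E)%E.
  apply: le_trans TM; apply: ereal_sup_ubound; exists (c *: x) => //=.
  by rewrite nrmZ nc mulVf.
by rewrite lee_fin linear_homZ// nrmZ nc mulrC ler_pdivrMr.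
Qed.

End operator_norm.

(** * The dual action on C_c(G, A) *)

Section dual_action.
Context (R : realType) (G : topologicalZmodType).

Lemma dual_conjK (s : dual R G) g : s g * (s g)^* = 1.
Proof.
have -> : s g * (s g)^* = (s - s) g by [].
by rewrite subrr.
Qed.

Lemma dual_scale_Cc (V : normedModType R[i]) (s : dual R G) (f : Cc G V) :
  (fun g => s g *: f g) \in @is_Cc R G V.
Proof.
have := CcP f; rewrite !inE => -[cf [K cK fK]]; split.
  by move=> g; apply: cvgZ; [exact: dual_continuous|exact: cf].
by exists K => // g Kg; rewrite fK// scaler0.
Qed.

Context (A : banachAlgType R[i]).
Implicit Types (s t : dual R G) (a b : Cc G A).

Lemma dual_actD s t a : dual_act (s + t) a = dual_act s (dual_act t a).
Proof. by apply/val_inj/funext => g /=; rewrite scalerA rmorphM. Qed.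

Lemma dual_act0 a : dual_act 0 a = a.
Proof. by apply/val_inj/funext => g /=; rewrite rmorph1 scale1r. Qed.

Lemma dual_act_linear s : linear (@dual_act R G A s).
Proof.
move=> c a b; apply/val_inj/funext => g /=.
by rewrite !fctE scalerDr !scalerA mulrC.
Qed.

HB.instance Definition _ s :=
  GRing.isLinear.Build _ _ _ _ (@dual_act R G A s) (dual_act_linear s).

Lemma nrm_conj_dual s g : nrm ((s g)^*) = 1.
Proof. by rewrite /nrm conjc_norm dual_norm1. Qed.

(** The twists at [h] and at [g - h] multiply to the twist at [g], a scalar of modulus 1 that can be
    taken out of the integral over [h]. *)
Lemma dual_act_convolution (nu : {measure set (borel G) -> \bar R})
    (alpha : G -> A -> A) s a b : (forall h, linear (alpha h)) ->
  dual_act s (convolution nu alpha a b) =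
  convolution nu alpha (dual_act s a) (dual_act s b).
Proof.
move=> la.
have E : convolution_fun nu alpha (dual_act s a) (dual_act s b) =
    (fun g => (s g)^* *: convolution_fun nu alpha a b g).
  apply/funext => g; rewrite /convolution_fun.
  rewrite -(@bochner_isometry _ _ _ nu A A (GRing.scale (s g)^*) (GRing.scale (s g))).
  - congr bochner; apply/funext => h /=.
    rewrite linear_homZ// bscalerAl bscalerAr scalerA; congr (_ *: _).
    by rewrite -rmorphM -dualD [X in s X]addrC subrK.
  - by move=> x; rewrite nrmZ nrm_conj_dual mul1r.
  - by move=> x /=; rewrite scalerA dual_conjK scale1r.
  - by move=> x /=; rewrite scalerA mulrC dual_conjK scale1r.
apply/val_inj; rewrite /convolution E /=.
(* Two cases because of the default value of [insubd]: twisting by [- s] undoes the twist, so the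
   twisted convolution is in C_c exactly when the original is; if neither is, both sides are 0. *)
have [cab|cab] := boolP (convolution_fun nu alpha a b \in @is_Cc R G A).
  have cs := dual_act_Cc s (MkCc cab).
  by rewrite !insubdK.
have cs : (fun g => (s g)^* *: convolution_fun nu alpha a b g) \notin @is_Cc R G A.
  apply: contra cab => cs; have := dual_act_Cc (- s) (MkCc cs).
  rewrite [X in X \in _](_ : _ = convolution_fun nu alpha a b)//.
  apply/funext => g /=; rewrite conjCK scalerA dual_conjK scale1r//.
rewrite /insubd !insubF ?(negbTE cab) ?(negbTE cs)//=.
by apply/funext => g; rewrite scaler0.
Qed.

End dual_action.

(** * Conjugation of regular representations by characters, and the reduced norm *)

Section regular_conjugation.
Context (R : realType) (p : R) (p1 : 1 <= p) (G : topologicalZmodType).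
Context (nu : {measure set (borel G) -> \bar R}) (nu_haar : is_haar nu).
Context (A : banachAlgType R[i]) (alpha : G -> A -> A).

Section on_X.
Context d (X : measurableType d) (mu : {sigma_finite_measure set X -> \bar R}).
Local Notation E := (Lp mu p1).
Local Notation EG := (Lp (nu \x mu)%E p1).
Context (pi0 : A -> E -> E) (pi : A -> EG -> EG) (s : dual R G).

Definition conj_rep (a : A) (xi : EG) : EG := dual_mul s (pi a (dual_mul (- s) xi)).

(* Conjugation by the multiplication operator fixes the defining formula of
   regular representations, which acts fibrewise over G. *)
Lemma is_regular_conj : is_representation pi0 -> is_regular alpha pi0 pi ->
  is_regular alpha pi0 conj_rep.
Proof.
move=> rep0 [rep ctr regE].
have iso_s xi : nrm (dual_mul s xi : EG) = nrm xi by exact: nrm_dual_mul.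
have iso_Ns xi : nrm (dual_mul (- s) xi : EG) = nrm xi by exact: nrm_dual_mul.
have conjE (T : EG -> EG) :
    opnorm (fun xi => dual_mul s (T (dual_mul (- s) xi))) = opnorm T.
  exact: (opnorm_conj T iso_s iso_Ns (@dual_mulKV R G nu _ X mu p p1 s)).
split.
- split.
  + move=> a; have [la ca] := rep_bounded rep a; split.
      by move=> c x y; rewrite /conj_rep (dual_mul_linear (- s)) la (dual_mul_linear s).
    move=> x; apply: (continuous_comp (f := dual_mul (- s)) (g := fun y => dual_mul s (pi a y))).
      exact: isometry_continuous (dual_mul_linear (- s)) iso_Ns x.
    apply: continuous_comp; [exact: ca|].
    exact: isometry_continuous (dual_mul_linear s) iso_s _.
  + by move=> xi c a b; rewrite /conj_rep (rep_linear rep) (dual_mul_linear s).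
  + by move=> a b xi; rewrite /conj_rep (rep_mul rep) dual_mulKV.
  + move=> a; rewrite [X in X @ _ --> _](_ : _ = fun b => opnorm (pi b \- pi a)).
      exact: rep_continuous.
    apply/funext => b; rewrite -[RHS]conjE; congr opnorm.
    by apply/funext => xi; rewrite /conj_rep /= dual_mulB.
- by move=> a; rewrite (conjE (pi a)).
- move=> a f xi xif.
  (* The formula for [pi] is used at the vector [dual_mul (- s) xi], whose field is [f] times the
     conjugate of [s]; multiplying the result by [s h] cancels this scalar, as [pi0 (alpha (- h) a)]
     is linear. *)
  have := regE a (MkCc (dual_scale_Cc (- s) f)) _ (dual_mul_field (- s) xif).
  move=> /(dual_mul_field s); congr is_field_of; apply/funext => h /=.
  have [l0 _] := rep_bounded rep0 (alpha (- h) a).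
  by rewrite (linear_homZ l0) scalerA dual_conjK scale1r.
Qed.

(** Moving u_(-s) past v_g produces the conjugate of s(g), which is absorbed into [a g] and gives
    the twist. The outer u_s comes out of the integral, and neither multiplication changes the
    operator norm. *)
Lemma integrated_form_conj (a : Cc G A) : is_representation pi ->
  opnorm (integrated_form conj_rep a) = opnorm (integrated_form pi (dual_act s a)).
Proof.
move=> rep.
have -> : integrated_form (conj_rep) a =
    (fun xi => dual_mul s (integrated_form pi (dual_act s a) (dual_mul (- s) xi))).
  apply/funext => xi; rewrite /integrated_form.
  have /esym -> := @bochner_isometry _ _ _ nu EG EG (dual_mul s) (dual_mul (- s))
    (fun g => pi (dual_act s a g) (translation g (dual_mul (- s) xi)))
    (@nrm_dual_mul R G nu _ X mu p p1 s)
    (@dual_mulKV R G nu _ X mu p p1 s) (@dual_mulVK R G nu _ X mu p p1 s).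
  congr bochner; apply/funext => g; rewrite /conj_rep /=; congr (dual_mul s _).
  rewrite dual_mul_translation//; have [la _] := rep_bounded rep (a g).
  by rewrite (linear_homZ la) (linear_homZ (rep_linear rep _)).
exact: (opnorm_conj _ (@nrm_dual_mul R G nu _ X mu p p1 s)
  (@nrm_dual_mul R G nu _ X mu p p1 (- s)) (@dual_mulKV R G nu _ X mu p p1 s)).
Qed.

(** [pi] is contractive and translations are isometric, so the integrand has norm at most [e] on [K]
    and vanishes elsewhere. *)
Lemma nrm_integrated_form (K : set G) (e : R) (b : Cc G A) (xi : EG) :
  measurable (K : set (borel G)) -> 0 <= e ->
  is_representation pi -> contractive pi ->
  (forall g, K g -> nrm (b g) <= e) -> (forall g, ~ K g -> b g = 0) ->
  nrm xi <= 1 -> ((nrm (integrated_form pi b xi))%:E <= e%:E * nu K)%E.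
Proof.
move=> mK e0 rep ctr bK b0 xi1.
have eK0 : (0 <= e%:E * nu K)%E by rewrite mule_ge0// lee_fin.
rewrite /integrated_form.
(* If the integrand is not Bochner integrable, the integral is 0 by convention and the bound is
   trivial. *)
have [bf|[-> _]] := bochnerP nu (fun g => pi (b g) (translation g xi)); last by rewrite nrm0.
apply: (le_trans (is_bochner_ler bf)).
rewrite -[X in (_ * nu X)%E]setIT -(integral_indic nu measurableT mK).
rewrite -ge0_integralZl//; last by apply/measurable_EFinP; exact: measurable_indic.
apply: ge0_le_integral => //.
- by move=> g _; rewrite lee_fin nrm_ge0.
- by apply/measurable_EFinP; exact: is_bochner_measurable bf.
- by apply/measurable_EFinP; apply: measurable_funM => //; exact: measurable_indic.
move=> g _; rewrite -EFinM lee_fin.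
have [lb _] := rep_bounded rep (b g).
apply: (le_trans (nrm_opnorm lb (ctr (b g)) _)).
rewrite nrm_translation// indicE; have [Kg|Kg] := boolP (g \in K).
  rewrite mulr1 (le_trans (ler_wpM2l (nrm_ge0 _) xi1))// mulr1; exact/bK/set_mem.
rewrite b0 ?nrm0 ?mul0r ?mulr0// => /mem_set; exact/negP.
Qed.

End on_X.

Lemma reduced_norm_dual_act (s : dual R G) (a : Cc G A) :
  reduced_norm p1 nu alpha (dual_act s a) = reduced_norm p1 nu alpha a.
Proof.
(* One inequality for all characters suffices: each norm for the twisted function is the norm for
   [b] at the conjugated representation, and the character [- s] gives the converse. *)
have le_act t (b : Cc G A) : (reduced_norm p1 nu alpha (dual_act t b) <=
    reduced_norm p1 nu alpha b)%E.
  apply: le_ereal_sup => _ [d [X [mu [pi0 [pi [rep0 ctr0 nd0 reg ->]]]]]].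
  exists d, X, mu, pi0, (conj_rep pi t).
  have E := integrated_form_conj t b (regular_rep reg).
  by split; [exact: rep0|exact: ctr0|exact: nd0|exact: is_regular_conj|exact: esym E].
have := le_act (- s) (dual_act s a); rewrite -dual_actD addNr dual_act0 => ge_a.
by apply/le_anti/andP; split; [exact: le_act|exact: ge_a].
Qed.

Lemma reduced_norm_ler (K : set G) (e : R) (b : Cc G A) :
  measurable (K : set (borel G)) -> 0 <= e ->
  (forall g, K g -> nrm (b g) <= e) -> (forall g, ~ K g -> b g = 0) ->
  (reduced_norm p1 nu alpha b <= e%:E * nu K)%E.
Proof.
move=> mK e0 bK b0; apply: ge_ereal_sup => _ [d [X [mu [pi0 [pi [_ _ _ reg ->]]]]]].
apply: ge_ereal_sup => _ [xi /= xi1 <-].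
by apply: nrm_integrated_form => //; [exact: regular_rep reg|exact: regular_contractive reg].
Qed.

End regular_conjugation.

(** * Density arguments and extension of isometries *)

Lemma dense_seq (R : realType) (V : normedModType R[i]) (S : set V) :
  dense S -> forall x : V, exists a_ : nat -> V,
  (forall n, S (a_ n)) /\ a_ n @[n --> \oo] --> x.
Proof.
move=> dS x.
have h (n : nat) : exists a, S a /\ nrm (x - a) < n.+1%:R^-1.
  have n0 : 0 < n.+1%:R^-1 :> R by rewrite invr_gt0.
  have /nbhs_interior := nrm_ball x n0.
  move=> /nbhs_singleton xU.
  have [|a [Ua Sa]] := dS _ _ (open_interior [set u | nrm (x - u) < n.+1%:R^-1]).
    by exists x.
  by exists a; split=> //; exact: interior_subset Ua.
have [a_ ha] := choice h; exists a_; split=> [n|]; first by have [] := ha n.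
apply/nrm_cvgP => e e0; near=> n; have [_ /lt_le_trans] := ha n; apply.
by apply: ltW; near: n; exact: (near_infty_natSinv_lt (PosNum e0)).
Unshelve. all: by end_near. Qed.

Lemma dense_continuous_eq (R : realType) (V W : normedModType R[i])
    (S T : V -> W) (X : set V) : dense X -> continuous S -> continuous T ->
  (forall x, X x -> S x = T x) -> S = T.
Proof.
move=> dX cS cT ST; apply/funext => x; have [a_ [Xa ax]] := dense_seq dX x.
have Sx : S (a_ n) @[n --> \oo] --> S x by exact: continuous_cvg (cS x) ax.
have Tx : T (a_ n) @[n --> \oo] --> T x by exact: continuous_cvg (cT x) ax.
have E : (fun n => S (a_ n)) = (fun n => T (a_ n)) by apply/funext => n; exact/ST.
by rewrite E in Sx; exact: (cvg_unique (@norm_hausdorff _ W) Sx Tx).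
Qed.

Section isometry_extension.
Context (R : realType) (D : lmodType R[i]) (V : normedModType R[i]).
Context (W : completeNormedModType R[i]).
Context (i : {linear D -> V}) (j : {linear D -> W}).
Hypotheses (di : dense (range i)) (ji : forall a, nrm (j a) = nrm (i a)).

(** The extension is built from its graph, the closure of the pairs (i a, j a), as [i] need not be
    injective. The isometry condition makes this closure the graph of a function. *)
Let graph_closure (x : V) (y : W) := exists a_ : nat -> D,
  i (a_ n) @[n --> \oo] --> x /\ j (a_ n) @[n --> \oo] --> y.

Let graph_nrm x y : graph_closure x y -> nrm y = nrm x.
Proof.
move=> [a_ [/cvg_nrm ix /cvg_nrm jy]].
have E : (fun n => nrm (j (a_ n))) = (fun n => nrm (i (a_ n))).
  by apply/funext => n; exact: ji.
by rewrite E in jy; exact: (cvg_unique (@norm_hausdorff _ R) jy ix).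
Qed.

Let graph_lin c x y x' y' : graph_closure x y -> graph_closure x' y' ->
  graph_closure (c *: x + x') (c *: y + y').
Proof.
move=> [a_ [ix jy]] [a'_ [ix' jy']]; exists (fun n => c *: a_ n + a'_ n); split.
  by under eq_fun do rewrite linearP; apply: cvgD => //; exact: cvgZr.
by under eq_fun do rewrite linearP; apply: cvgD => //; exact: cvgZr.
Qed.

Let graph_uniq x y y' : graph_closure x y -> graph_closure x y' -> y = y'.
Proof.
move=> xy xy'; apply/eqP; rewrite -subr_eq0; apply/eqP/nrm_eq0.
(* The pair (0, y - y') lies in the closure, so its second component has norm 0. *)
have := graph_nrm (graph_lin (-1) xy' xy).
by rewrite !scaleN1r addNr nrm0 addrC.
Qed.

Let graph_ex x : exists y, graph_closure x y.
Proof.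
have [b_ [ib bx]] := dense_seq di x.
have /choice[a_ ab] : forall n, exists a, i a = b_ n.
  by move=> n; have [a _ <-] := ib n; exists a.
have ax : i (a_ n) @[n --> \oo] --> x by under eq_fun do rewrite ab.
suff /cvg_ex[y jy] : cvg (j (a_ n) @[n --> \oo]) by exists y, a_.
apply/cauchy_cvgP/cauchyP => e e0.
have eR : e = (complex.Re e)%:C.
  by case: e e0 => a b; rewrite ltcE /= => /andP[/eqP ->].
have {}e0 : 0 < complex.Re e by rewrite -ltcR -eR.
have e20 : 0 < complex.Re e / 2 by rewrite divr_gt0.
have /nrm_cvgP/(_ _ e20)[N _ hN] := ax.
(* Distances between the [j (a_ n)] equal those between the convergent [i (a_ n)]; the ball is
   centred at [j (a_ N)]. *)
exists (j (a_ N)); exists N => // n Nn; rewrite /= -ball_normE /= eR -nrmC ltcR.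
rewrite -linearB ji linearB -(subrKA x) (le_lt_trans (ler_nrmD _ _))//.
rewrite [ltRHS]splitr ltrD//; last exact: hN.
by rewrite nrm_distC; apply: hN => /=.
Qed.

Lemma isometry_extension : exists T : V -> W,
  [/\ linear T, forall x, nrm (T x) = nrm x & forall a, T (i a) = j a].
Proof.
have [T hT] := choice graph_ex; exists T; split.
- by move=> c x y; apply: graph_uniq (hT _) _; exact: graph_lin.
- by move=> x; exact: graph_nrm.
- move=> a; apply: graph_uniq (hT _) _.
  by exists (fun=> a); split; exact: cvg_cst.
Qed.

End isometry_extension.

(** * Continuity of the product of a Banach algebra in each variable *)

Section bmul_continuous.
Context (R : realType) (B : banachAlgType R[i]).

Lemma nrm_bmul (x y : B) : nrm (bmul x y) <= nrm x * nrm y.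
Proof. by rewrite -lecR rmorphM /= !nrmC ler_bnormM. Qed.

Lemma lipschitz_nrm_continuous (V W : normedModType R[i]) (f : V -> W) (M : R) :
  0 <= M -> (forall x y, nrm (f x - f y) <= M * nrm (x - y)) -> continuous f.
Proof.
move=> M0 fM x; apply/nrm_cvgP => e e0.
(* [M] may be 0, so the radius is obtained by dividing by [M + 1]. *)
have M1 : 0 < M + 1 by rewrite ltr_wpDl.
apply: filterS (nrm_ball x (divr_gt0 e0 M1)) => y /= xy.
apply: (le_lt_trans (fM x y)); apply: (@le_lt_trans _ _ ((M + 1) * nrm (x - y))).
  by rewrite ler_wpM2r ?nrm_ge0// lerDl.
by rewrite mulrC -ltr_pdivlMr.
Qed.

Lemma bmul_continuousl (y : B) : continuous (bmul^~ y).
Proof.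
apply: (lipschitz_nrm_continuous (nrm_ge0 y)) => x x'.
have -> : bmul x y - bmul x' y = bmul (x - x') y.
  by rewrite -[in LHS](subrK x' x) bmulDl addrK.
by rewrite mulrC nrm_bmul.
Qed.

Lemma bmul_continuousr (x : B) : continuous (bmul x).
Proof.
apply: (lipschitz_nrm_continuous (nrm_ge0 x)) => y y'.
have -> : bmul x y - bmul x y' = bmul x (y - y').
  by rewrite -[in LHS](subrK y' y) bmulDr addrK.
exact: nrm_bmul.
Qed.

End bmul_continuous.

(** * The dual action on the reduced crossed product *)

Section reduced_crossed_product.
Context (R : realType) (p : R) (p1 : 1 <= p) (G : topologicalZmodType).
Context (G_hausdorff : hausdorff_space G).
Context (nu : {measure set (borel G) -> \bar R}) (nu_haar : is_haar nu).
Context (A : banachAlgType R[i]) (alpha : G -> A -> A).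
Context (F : banachAlgType R[i]) (iota : {linear Cc G A -> F}).
Context (F_reduced : is_reduced_crossed_product p1 nu alpha iota).
Implicit Types (s t : dual R G) (a b : Cc G A).

Lemma nrm_iota_dual_act s a : nrm (iota (dual_act s a)) = nrm (iota a).
Proof.
apply: EFin_inj; rewrite !(crossed_norm F_reduced).
exact: reduced_norm_dual_act.
Qed.

Lemma compact_borel (K : set G) : compact K -> measurable (K : set (borel G)).
Proof.
move=> cK; have oK : open (~` K) by exact: closed_openC (compact_closed G_hausdorff cK).
by rewrite -[K]setCK; apply: measurableC; exact: open_borel.
Qed.

Lemma Cc_bound a : exists M, 0 < M /\ forall g, nrm (a g) <= M.
Proof.
have := CcP a; rewrite inE => -[ca [K cK aK]].
have cna : continuous (fun g => nrm (a g)).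
  by move=> g; apply: cvg_nrm; exact: ca.
have := continuous_compact (continuous_subspaceT cna) cK.
move=> /compact_bounded[M [_ hM]].
exists (`|M| + 1); split; first by rewrite ltr_wpDl.
move=> g; have [Kg|Kg] := pselect (K g); last first.
  by rewrite aK// nrm0 addr_ge0.
rewrite (le_trans (ler_norm _))//; apply: (hM (`|M| + 1)); last by exists g.
by rewrite (le_lt_trans (ler_norm _))// ltrDl.
Qed.

(** The two twists differ by a function supported in [K], which is uniformly small there once [t] is
    close to [s] on [K] in the compact-open topology. *)
Lemma iota_dual_act_continuous a s (e : R) : 0 < e ->
  \forall t \near s, nrm (iota (dual_act s a) - iota (dual_act t a)) < e.
Proof.
move=> e0; have [M [M0 aM]] := Cc_bound a.
have := CcP a; rewrite inE => -[_ [K cK aK]].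
have fK := haar_compact nu_haar cK.
have K0 : 0 <= fine (nu K) by rewrite fine_ge0.
have KE : nu K = (fine (nu K))%:E by rewrite fineK// ge0_fin_numE.
have c0 : 0 < M * (fine (nu K) + 1) by rewrite mulr_gt0// ltr_wpDl.
(* Chosen so that [del * M] times the measure of [K] is below [e]; the added 1 keeps the denominator
   positive when [K] is null and makes the bound strict. *)
pose del := e / (M * (fine (nu K) + 1)).
have del0 : 0 < del by rewrite divr_gt0.
have [/(_ (@cvg_id _ _) K cK _ del0) + _] := dual_cvgP s (@nbhs_filter _ s).
apply: filterS => t st; rewrite -linearB -lte_fin (crossed_norm F_reduced).
apply: (@le_lt_trans _ _ ((del * M)%:E * nu K)%E).
  apply: reduced_norm_ler => //.
  - exact: compact_borel.
  - by rewrite mulr_ge0// ltW.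
  - move=> g Kg; rewrite /= !fctE -scalerBl nrmZ.
    rewrite ler_pM ?nrm_ge0//; rewrite /nrm conjc_sub_norm -/(nrm _); exact/ltW/st.
  - by move=> g Kg; rewrite /= !fctE aK// !scaler0 subrr.
rewrite KE -EFinM lte_fin -mulrA /del -[ltRHS]mulr1 -mulrA ltr_pM2l//.
by rewrite mulrC -ltr_pdivlMr ?invr_gt0// mul1r invrK ltr_pM2l// ltrDl.
Qed.

Lemma dual_action_exists : (forall h, linear (alpha h)) ->
  exists alphahat : dual R G -> F -> F, isometric_action alphahat /\
    forall s a, alphahat s (iota a) = iota (dual_act s a).
Proof.
move=> la.
have di := crossed_dense F_reduced.
(* Twisting by [s] preserves the norm of [iota a], so it extends from the dense range of [iota] to
   an isometry of [F]. *)
have h s : exists T : F -> F, [/\ linear T, forall x, nrm (T x) = nrm x &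
    forall a, T (iota a) = iota (dual_act s a)].
  exact: (@isometry_extension R (Cc G A) F F iota (iota \o @dual_act R G A s) di
    (nrm_iota_dual_act s)).
have [hat hatP] := choice h.
have hatL s : linear (hat s) by have [] := hatP s.
have hatN s x : nrm (hat s x) = nrm x by have [] := hatP s.
have hatE s a : hat s (iota a) = iota (dual_act s a) by have [] := hatP s.
have hatC s : continuous (hat s) by exact: isometry_continuous.
exists hat; split=> //; split; last by move=> s x; rewrite -!nrmC hatN.
split=> //.
- move=> s.
  (* Multiplicativity extends by density one factor at a time: first the right one, with the left in
     the range of [iota], then the left one. *)
  have hatM_iota a : (fun x => hat s (bmul (iota a) x)) =
      (fun x => bmul (hat s (iota a)) (hat s x)).
    apply: (dense_continuous_eq di).
    + move=> x; apply: (continuous_comp (f := bmul (iota a)) (g := hat s)).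
        exact: bmul_continuousr.
      exact: hatC.
    + move=> x; apply: (continuous_comp (f := hat s) (g := bmul (hat s (iota a)))).
        exact: hatC.
      exact: bmul_continuousr.
    + move=> _ [b _ <-]; rewrite -(crossed_mul F_reduced) !hatE.
      by rewrite dual_act_convolution// (crossed_mul F_reduced).
  move=> x y.
  suff : (fun x => hat s (bmul x y)) = (fun x => bmul (hat s x) (hat s y)).
    by move/(congr1 (fun f => f x)).
  apply: (dense_continuous_eq di).
  + move=> z; apply: (continuous_comp (f := bmul^~ y) (g := hat s)).
      exact: bmul_continuousl.
    exact: hatC.
  + move=> z; apply: (continuous_comp (f := hat s) (g := bmul^~ (hat s y))).
      exact: hatC.
    exact: bmul_continuousl.
  + by move=> _ [a _ <-]; have /(congr1 (fun f => f y)) := hatM_iota a.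
- move=> x; suff : hat 0 = id by move=> ->.
  apply: (dense_continuous_eq di (hatC 0)) => [z|_ [a _ <-]]; first exact: cvg_id.
  by rewrite hatE dual_act0.
- move=> s t x; suff : hat (s + t) = hat s \o hat t by move=> ->.
  apply: (dense_continuous_eq di) => [||_ [a _ <-]]; first exact: hatC.
    by move=> z; apply: continuous_comp; exact: hatC.
  by rewrite /= !hatE dual_actD.
- move=> x s; apply/(nrm_cvgP (@nbhs_filter (dual R G) s)) => e e0.
  have e30 : 0 < e / 3 by rewrite divr_gt0.
  have [x_ [ix /nrm_cvgP/(_ _ e30)[N _ hN]]] := dense_seq di x.
  have [a _ ax] := ix N; have {}hN : nrm (x - iota a) < e / 3.
    by rewrite ax; apply: hN => /=.
  apply: (@filterS _ _ (@nbhs_filter (dual R G) s)) (iota_dual_act_continuous a s e30) => t st.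
  (* The outer terms are below [e / 3] because [hat s] and [hat t] are isometric and [iota a]
     approximates [x], the middle one because [t] is close to [s]. *)
  rewrite (_ : _ - _ = hat s (x - iota a) + (iota (dual_act s a) - iota (dual_act t a))
      + hat t (iota a - x)); last first.
    by rewrite (linear_homB (hatL s)) (linear_homB (hatL t)) !hatE !subrKA.
  have -> : e = e / 3 + e / 3 + e / 3 by field.
  rewrite (le_lt_trans (ler_nrmD _ _))// hatN ltrD//; last by rewrite nrm_distC.
  by rewrite (le_lt_trans (ler_nrmD _ _))// hatN ltrD.
Qed.

End reduced_crossed_product.

Theorem theorem3p20 (R : realType) (p : R) (p1 : 1 <= p)
  (G : topologicalZmodType)
  (G_hausdorff : hausdorff_space G)
  (G_locally_compact : locally_compact [set: G])
  (G_second_countable : @second_countable G)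
  (nu : {measure set (borel G) -> \bar R}) (nu_haar : is_haar nu)
  (A : banachAlgType R[i]) (A_Lp : is_Lp_operator_algebra p1 A)
  (alpha : G -> A -> A) (alpha_action : isometric_action alpha)
  (A_separable : separable A)
  (A_nondegenerate : nondegenerately_representable p1 A)
  (F : banachAlgType R[i]) (iota : {linear Cc G A -> F})
  (F_reduced : is_reduced_crossed_product p1 nu alpha iota) :
  exists! alphahat : dual R G -> F -> F,
    isometric_action alphahat /\
    forall (tau : dual R G) (a : Cc G A),
      alphahat tau (iota a) = iota (dual_act tau a).
Proof.
have [hat [hat_act hatE]] := dual_action_exists G_hausdorff nu_haar F_reduced
  (action_linear (proj1 alpha_action)).
exists hat; split=> // hat' [hat'_act hat'E]; apply/funext => s.
(* For uniqueness, both maps attached to [s] are continuous on [F] and agree on the dense range of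
   [iota]. *)
apply: (dense_continuous_eq (crossed_dense F_reduced)).
- exact: action_continuous (proj1 hat_act) s.
- exact: action_continuous (proj1 hat'_act) s.
- by move=> _ [a _ <-]; rewrite hatE hat'E.
Qed.
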